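(* Let $\mu_1,\mu_2$ be Borel probability measures on $\mathbb R$. There exist unique functions $Z_1$ and $Z_2$ in the class $\mathcal F$ such that, for all $z\in\mathbb C^+$, $$z=Z_1(z)+Z_2(z)-F_{\mu_1}(Z_1(z))\quad\text{and}\quad F_{\mu_1}(Z_1(z))=F_{\mu_2}(Z_2(z)).$$
   Context: $\mathbb C^+$ is the open upper half-plane. For a Borel probability measure $\mu$ on $\mathbb R$, its Cauchy transform is $G_\mu(z)=\int_{\mathbb R}\frac{\mu(dt)}{z-t}$, $z\in\mathbb C^+$, and its reciprocal Cauchy transform is $F_\mu(z)=1/G_\mu(z)$, $z\in\mathbb C^+$. $\mathcal F$ is the class of all functions $F_\mu$ with $\mu$ a Borel probability measure on $\mathbb R$; equivalently, $\mathcal F$ is the class of analytic functions $F:\mathbb C^+\to\mathbb C^+\cup\mathbb R$ such that $F(z)/z\to1$ as $z\to\infty$ nontangentially (i.e. with $|\operatorname{Re} z|/\operatorname{Im} z$ staying bounded); such functions map $\mathbb C^+$ into $\mathbb C^+$. *)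

(* Defs.v *)
From HB Require Import structures.
From mathcomp Require Import all_boot all_order all_algebra.
From mathcomp Require Import complex.
From mathcomp Require Import all_classical all_reals all_analysis.

Set Implicit Arguments.
Unset Strict Implicit.
Unset Printing Implicit Defensive.

Import Order.TTheory GRing.Theory Num.Theory.

Local Open Scope classical_set_scope.
Local Open Scope ring_scope.
Local Open Scope complex_scope.

(* [complex.Im] is the real-valued imaginary part. The order of [R[i]] is the
   partial one, where [0 < z] would mean that z is real and positive. *)
Definition upper_half_plane (R : realType) : set R[i] :=
  [set z : R[i] | 0 < complex.Im z].

(* The complex integral is taken componentwise. For z in the upper half-plane
   the integrand is continuous in t and bounded by 1 / Im z, so both components
   are integrable. *)
Definition cauchy_transform (R : realType)
    (mu : probability (measurableTypeR R) R) (z : R[i]) : R[i] :=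
  (\int[mu]_t complex.Re (z - t%:C)^-1) +i*
  (\int[mu]_t complex.Im (z - t%:C)^-1).

Definition reciprocal_cauchy_transform (R : realType)
    (mu : probability (measurableTypeR R) R) (z : R[i]) : R[i] :=
  (cauchy_transform mu z)^-1.

(* Functions on the upper half-plane are represented by total functions on
   [R[i]] whose values elsewhere are irrelevant. *)
Definition class_F (R : realType) (Z : R[i] -> R[i]) : Prop :=
  exists mu : probability (measurableTypeR R) R,
    forall z, upper_half_plane z -> Z z = reciprocal_cauchy_transform mu z.

(* The compositions are meaningful because members of [class_F] map the upper
   half-plane into itself. *)
Definition subordination_pair (R : realType)
    (mu1 mu2 : probability (measurableTypeR R) R)
    (Z1 Z2 : R[i] -> R[i]) : Prop :=
  [/\ class_F Z1, class_F Z2 &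
   forall z, upper_half_plane z ->
     z = Z1 z + Z2 z - reciprocal_cauchy_transform mu1 (Z1 z) /\
     reciprocal_cauchy_transform mu1 (Z1 z) =
       reciprocal_cauchy_transform mu2 (Z2 z)].

(* Main.v *)
Require Import Defs.
From mathcomp Require Import all_boot all_order all_algebra.
From mathcomp Require Import complex.
From mathcomp Require Import all_classical all_reals all_analysis.
From mathcomp Require Import measurable_realfun.
From mathcomp Require Import ring lra.

(** Write [h_i z = F_i z - z], where [F_i] is the reciprocal Cauchy transform of
    [mu_i] ([defect] below). Eliminating [Z2], the two equations say that
    [Z2 z = z + h_1 (Z1 z)] and that [w = Z1 z] is a fixed point of
    [T_z w = z + h_2 (z + h_1 w)]. Two things have to be shown: for each [z] in the
    upper half-plane [T_z] has exactly one fixed point there, and the functions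
    so obtained are reciprocal Cauchy transforms of probability measures.

    Everything rests on one property of [h = h_i]. Its Pick kernel
    [(h z - (h w)^* ) / (z - w^* )] is the Gram kernel in [L^2(mu_i)] of the
    functions [t |-> F_i z / (z - t) - 1] ([pick_defectE]). Hence its entrywise
    product with any positive matrix is positive ([pick_multiplier_defect]). On two
    points this is the Schwarz-Pick inequality ([schwarz_pick]): [h] does not
    increase hyperbolic distances.

    Fixed points. Adding [z] after [h] strictly decreases hyperbolic distances
    ([hdist_shift_le]), which gives uniqueness. For existence, dominated convergence
    shows that [h (in) / n] tends to 0; then, for [r] large, Schwarz-Pick against
    the point [ir] produces a bounded hyperbolic disk that is invariant under both
    [w |-> z + h_1 w] and [w |-> z + h_2 w] ([disk_shift]), on which [T_z] is a
    uniform contraction ([shift_fixpoint]). Centring the disk at [z = in] also shows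
    that [Z1 (in) / in] and [Z2 (in) / in] come arbitrarily close to 1
    ([subordination_growth]).

    Membership in the class. If the Pick kernel of [A] minus 1 is positive, so is
    that of [z |-> z + h (A z)] ([pick_positive_shift]); starting from [A z = z] and
    passing to the limit along the iteration of [T_z], the kernels of [Z1] and [Z2]
    minus 1 are positive. It remains to recover a measure from such a kernel
    ([class_F_of_pick]). For finitely many points of the half-plane, positivity and
    the spectral theorem for a Hermitian matrix yield a discrete measure, of mass at
    most 1, whose Cauchy transform takes the values of [1 / Z] at these points
    ([finite_interpolation]). Describing these measures by their quantile functions,
    with the line compactified to [-1, 1], Helly's theorem ([helly_selection])
    provides a limit that interpolates on a dense sequence of points, hence
    everywhere by continuity; the behaviour on the imaginary axis ensures that no
    mass escapes to infinity. *)

Set Implicit Arguments.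
Unset Strict Implicit.
Unset Printing Implicit Defensive.

Import Order.TTheory GRing.Theory Num.Theory.
Import numFieldNormedType.Exports.

Local Open Scope classical_set_scope.
Local Open Scope ring_scope.
Local Open Scope complex_scope.
(* [complex_scope] uses this notation for another, convertible, conjugation. *)
Local Notation "z ^*" := (Num.conj z) : complex_scope.


(** * The complex plane and its upper half-plane *)

Section complex_plane.
Context {R : realType}.
Implicit Types (x y : R) (a b c z w : R[i]).
Local Notation Re := complex.Re.
Local Notation Im := complex.Im.

(** The squared modulus, taken in [R]: the norm of [R[i]] takes its values in
    [R[i]], whose order is only partial. *)
Definition nsq z : R := Re z ^+ 2 + Im z ^+ 2.

Lemma cReD a b : Re (a + b) = Re a + Re b. Proof. by case: a b => ? ? [? ?]. Qed.
Lemma cImD a b : Im (a + b) = Im a + Im b. Proof. by case: a b => ? ? [? ?]. Qed.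
Lemma cReN a : Re (- a) = - Re a. Proof. by case: a. Qed.
Lemma cImN a : Im (- a) = - Im a. Proof. by case: a. Qed.
Lemma cReM a b : Re (a * b) = Re a * Re b - Im a * Im b.
Proof. by case: a b => ? ? [? ?]. Qed.
Lemma cImM a b : Im (a * b) = Re a * Im b + Im a * Re b.
Proof. by case: a b => ? ? [? ?]. Qed.
Lemma cReJ a : Re a^* = Re a. Proof. by case: a. Qed.
Lemma cImJ a : Im a^* = - Im a. Proof. by case: a. Qed.
Lemma cReV a : Re a^-1 = Re a / nsq a. Proof. by case: a. Qed.
Lemma cImV a : Im a^-1 = - (Im a / nsq a). Proof. by case: a. Qed.

Definition ReImE := (cReD, cImD, cReN, cImN, cReM, cImM, cReJ, cImJ).

Lemma complexP a b : Re a = Re b -> Im a = Im b -> a = b.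
Proof. by case: a b => ? ? [? ?] /= -> ->. Qed.

Lemma Re_sum (I : Type) (r : seq I) (F : I -> R[i]) :
  Re (\sum_(i <- r) F i) = \sum_(i <- r) Re (F i).
Proof. by elim/big_ind2: _ => // ? ? ? ? <- <-; rewrite cReD. Qed.

Lemma nsq_ge0 z : 0 <= nsq z. Proof. by rewrite addr_ge0// sqr_ge0. Qed.

Lemma nsqM a b : nsq (a * b) = nsq a * nsq b.
Proof. by rewrite /nsq !ReImE; ring. Qed.

Lemma nsqN a : nsq (- a) = nsq a. Proof. by rewrite /nsq !ReImE; ring. Qed.

Lemma nsqJ a : nsq a^* = nsq a. Proof. by rewrite /nsq !ReImE; ring. Qed.

Lemma nsq_eq0 a : (nsq a == 0) = (a == 0).
Proof. by rewrite /nsq paddr_eq0 ?sqr_ge0// !sqrf_eq0 eq_complex. Qed.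

Lemma nsq_gt0 a : (0 < nsq a) = (a != 0).
Proof. by rewrite lt_def nsq_ge0 andbT nsq_eq0. Qed.

Lemma nsqV a : nsq a^-1 = (nsq a)^-1.
Proof.
have [->|a0] := eqVneq a 0; first by rewrite invr0 /nsq /= expr0n addr0 invr0.
apply: (mulfI (x := nsq a)); first by rewrite nsq_eq0.
rewrite -nsqM !mulfV ?nsq_eq0//.
by rewrite /nsq/= expr1n expr0n addr0.
Qed.

(** The conjugation rules are restated for [Num.conj] on [R[i]] itself: after
    the generic morphism rules, simplification would unfold the conjugation of
    [R[i]] into components. *)
Lemma conjcR x : x%:C^* = x%:C. Proof. exact: conjc_real. Qed.

Lemma conjcB a b : (a - b)^* = a^* - b^*. Proof. exact: rmorphB. Qed.

Lemma conjcM a b : (a * b)^* = a^* * b^*. Proof. exact: rmorphM. Qed.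

Lemma conjcV a : (a^-1)^* = (a^*)^-1. Proof. exact: fmorphV. Qed.

Lemma conjc1 : 1^* = 1 :> R[i]. Proof. exact: rmorph1. Qed.

Lemma conjc_neq0 z : (z^* != 0) = (z != 0). Proof. by rewrite fmorph_eq0. Qed.

Lemma mulcJ z : z * z^* = (nsq z)%:C.
Proof. by apply: complexP; rewrite /nsq !ReImE/=; ring. Qed.

Lemma subJ z : z - z^* = 0 +i* (2 * Im z).
Proof. by apply: complexP; rewrite !ReImE/=; ring. Qed.

Lemma Re_le_nsq z x : 0 <= x -> nsq z <= x ^+ 2 -> `|Re z| <= x.
Proof.
move=> x0 zx; rewrite -(@ler_pXn2r _ 2)// ?nnegrE// real_normK ?num_real//.
by apply: le_trans zx; rewrite lerDl sqr_ge0.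
Qed.

Lemma Im_le_nsq z x : 0 <= x -> nsq z <= x ^+ 2 -> `|Im z| <= x.
Proof.
move=> x0 zx; rewrite -(@ler_pXn2r _ 2)// ?nnegrE// real_normK ?num_real//.
by apply: le_trans zx; rewrite lerDr sqr_ge0.
Qed.

Lemma nsqD_le a b : nsq (a + b) <= 2 * nsq a + 2 * nsq b.
Proof.
have := sqr_ge0 (Re a - Re b); have := sqr_ge0 (Im a - Im b).
by rewrite /nsq !ReImE; nra.
Qed.

Lemma ge0cP z : reflect (Im z = 0 /\ 0 <= Re z) (0 <= z).
Proof.
rewrite lecE /=; apply: (iffP andP) => [[/eqP -> ->]//|[-> ->]].
by rewrite eqxx.
Qed.

Local Notation upper := (@upper_half_plane R).

Lemma upper_neq0 z : upper z -> z != 0.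
Proof. by rewrite /upper_half_plane/=; apply: contraTneq => ->; rewrite ltxx. Qed.

Lemma upper_nsq z : upper z -> 0 < nsq z.
Proof. by move=> /upper_neq0; rewrite nsq_gt0. Qed.

Lemma upper_sub_real z x : upper z -> upper (z - x%:C).
Proof. by rewrite /upper_half_plane/= !ReImE/= oppr0 addr0. Qed.

Lemma upper_sub_conj z w : upper z -> upper w -> z - w^* != 0.
Proof.
rewrite /upper_half_plane/= => z0 w0.
by apply: upper_neq0; rewrite /upper_half_plane/= !ReImE opprK addr_gt0.
Qed.

Lemma upperD z w : upper z -> 0 <= Im w -> upper (z + w).
Proof. by rewrite /upper_half_plane/= cImD => z0 w0; rewrite ltr_pwDl. Qed.

End complex_plane.

(** * Positive kernels and the Pick kernel *)

Section positive_kernels.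
Context {R : realType}.
Local Notation C := R[i].
Local Notation upper := (@upper_half_plane R).
Local Notation Re := complex.Re.
Local Notation Im := complex.Im.

(** In the order of [R[i]] the condition also says that the form is real, so it
    forces [M] to be Hermitian. *)
Definition psd n (M : 'I_n -> 'I_n -> C) :=
  forall x : 'I_n -> C, 0 <= \sum_i \sum_j x i * (x j)^* * M i j.

Lemma psd_ext n (M N : 'I_n -> 'I_n -> C) :
  (forall i j, M i j = N i j) -> psd M -> psd N.
Proof.
move=> MN pM x; have := pM x.
by under eq_bigr do under eq_bigr do rewrite MN.
Qed.

Lemma psd_cong n (M : 'I_n -> 'I_n -> C) (c : 'I_n -> C) :
  psd M -> psd (fun i j => c i * (c j)^* * M i j).
Proof.
move=> pM x; have := pM (fun i => x i * c i).
under eq_bigr => i _.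
  under eq_bigr => j _.
    rewrite conjcM (_ : _ * _ * _ = x i * (x j)^* * (c i * (c j)^* * M i j)).
      over.
    by ring.
  over.
by [].
Qed.

Lemma psd1 n : psd (fun _ _ : 'I_n => 1 : C).
Proof.
move=> x; under eq_bigr => i _.
  under eq_bigr do rewrite mulr1.
  rewrite -mulr_sumr -rmorph_sum/=.
  over.
by rewrite -mulr_suml mulcJ ler0c nsq_ge0.
Qed.

Lemma psdD n (M N : 'I_n -> 'I_n -> C) :
  psd M -> psd N -> psd (fun i j => M i j + N i j).
Proof.
move=> pM pN x.
under eq_bigr do under eq_bigr do rewrite mulrDr.
by under eq_bigr do rewrite big_split/=; rewrite big_split/= addr_ge0.
Qed.

Lemma psd0 n : psd (fun _ _ : 'I_n => 0 : C).
Proof.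
move=> x; rewrite big1// => i _; rewrite big1// => j _; rewrite mulr0//.
Qed.

Lemma psd_diag (M : 'I_1 -> 'I_1 -> C) : psd M -> 0 <= M ord0 ord0.
Proof.
move=> /(_ (fun=> 1)); rewrite !big_ord1 => H.
by rewrite -[M _ _]mul1r -[X in X * _](mulr1 1) -[X in _ * X * _]conjc1.
Qed.

(** The real [t] below is a free parameter: when [q] is positive the choice
    [t = q] gives the determinant, and when [q = 0] a small positive [t] rules out
    a nonzero off-diagonal entry. *)
Lemma psd_det2 (M : 'I_2 -> 'I_2 -> C) (p q : R) : psd M ->
  M ord0 ord0 = p%:C -> M ord_max ord_max = q%:C ->
  M ord_max ord0 = (M ord0 ord_max)^* ->
  0 <= p -> 0 <= q -> nsq (M ord0 ord_max) <= p * q.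
Proof.
move=> pM E00 E11 E10 p0 q0; set c := M ord0 ord_max in E10 *.
have key (t : R) : 0 <= t ^+ 2 * p - 2 * t * nsq c + nsq c * q.
  have := pM (fun i => if i == ord0 then t%:C else - c).
  rewrite !big_ord_recl !big_ord0 /= !addr0.
  have -> : lift ord0 ord0 = ord_max :> 'I_2 by apply/val_inj.
  rewrite E00 E11 E10 -/c => /ge0cP[_].
  by rewrite !ReImE/= /nsq; congr (_ <= _); ring.
have [q00|qn0] := eqVneq q 0; last first.
  have q_gt0 : 0 < q by rewrite lt_def qn0.
  have := key q; rewrite (_ : _ + _ = q * (p * q - nsq c)); last by ring.
  by rewrite pmulr_rge0// subr_ge0.
have := key (nsq c / (p + 1)).
have p1 : 0 < p + 1 by lra.
rewrite q00 !mulr0 addr0 expr2.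
set s := nsq c / (p + 1).
have -> : nsq c = s * (p + 1) by rewrite /s mulfVK// gt_eqF.
have s0 : 0 <= s by rewrite /s divr_ge0 ?nsq_ge0 ?ltW.
have [->|sn] := eqVneq s 0; first by rewrite !mul0r.
have sp : 0 < s by rewrite lt_def sn.
rewrite (_ : _ - _ = - (s ^+ 2 * (p + 2))); last by ring.
rewrite oppr_ge0 leNgt mulr_gt0 ?exprn_gt0//; lra.
Qed.

(** The Nevanlinna-Pick kernel; on the diagonal it is [Im (h z) / Im z]. *)
Definition pick (h : C -> C) (z w : C) := (h z - (h w)^*) / (z - w^*).

Definition pick_positive (h : C -> C) := forall n (w : 'I_n -> C),
  (forall i, upper (w i)) -> psd (fun i j => pick h (w i) (w j)).

(** By the Schur product theorem this follows from [pick_positive]. It is kept as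
    a separate notion because for the functions of interest it is proved directly,
    by integrating a pointwise inequality. *)
Definition pick_multiplier (h : C -> C) := forall n (w : 'I_n -> C),
  (forall i, upper (w i)) -> forall M : 'I_n -> 'I_n -> C, psd M ->
  psd (fun i j => pick h (w i) (w j) * M i j).

Lemma pick_multiplier_positive h : pick_multiplier h -> pick_positive h.
Proof.
move=> hh n w uw; apply: psd_ext (hh n w uw _ (@psd1 n)) => i j.
by rewrite mulr1.
Qed.

Lemma pick_diag h z : upper z -> pick h z z = (Im (h z) / Im z)%:C.
Proof.
rewrite /upper_half_plane/= => z0; rewrite /pick !subJ.
apply: (mulIf (x := 0 +i* (2 * Im z))).
  by rewrite eq_complex/= eqxx/= mulf_neq0 ?gt_eqF//.
rewrite divfK; last by rewrite eq_complex/= eqxx/= mulf_neq0 ?gt_eqF//.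
by apply: complexP; rewrite !ReImE/=; field; rewrite gt_eqF.
Qed.

Lemma pickJ h z w : (pick h z w)^* = pick h w z.
Proof.
rewrite /pick conjcM conjcV !conjcB !conjCK.
by rewrite -[in LHS]opprB -[in X in _ / X]opprB invrN mulrNN.
Qed.

Lemma pick_Im_ge0 h z : pick_positive h -> upper z -> 0 <= Im (h z).
Proof.
move=> ph z0; have /psd_diag := ph 1%N (fun=> z) (fun=> z0).
by rewrite pick_diag// ler0c pmulr_lge0// invr_gt0.
Qed.

Lemma nsq_sub_conj (a b : C) : nsq (a - b^*) = nsq (a - b) + 4 * Im a * Im b.
Proof. by rewrite /nsq !ReImE; ring. Qed.

(** The Schwarz-Pick inequality is the positivity of the determinant of the Pick
    matrix at [z] and [w]. The determinant involves [z - w^*], which is traded for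
    [z - w] by [nsq_sub_conj]. *)
Lemma schwarz_pick h z w : pick_positive h -> upper z -> upper w ->
  nsq (h z - h w) * (Im z * Im w) <= nsq (z - w) * (Im (h z) * Im (h w)).
Proof.
move=> ph uz uw.
have z0 : 0 < Im z := uz.
have w0 : 0 < Im w := uw.
pose v (i : 'I_2) := if i == ord0 then z else w.
have uv i : upper (v i) by rewrite /v; case: ifP.
have := psd_det2 (ph 2%N v uv) (pick_diag _ (uv _)) (pick_diag _ (uv _)) _.
rewrite /v /= pickJ => /(_ erefl).
have hz : 0 <= Im (h z) / Im z by rewrite divr_ge0 ?pick_Im_ge0// ltW.
have hw : 0 <= Im (h w) / Im w by rewrite divr_ge0 ?pick_Im_ge0// ltW.
move=> /(_ hz hw); rewrite /pick nsqM nsqV !nsq_sub_conj.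
have D : 0 < nsq (z - w) + 4 * Im z * Im w.
  by have := nsq_ge0 (z - w); have := mulr_gt0 z0 w0; nra.
rewrite ler_pdivrMr// mulrACA -invfM [X in _ <= X]mulrAC ler_pdivlMr ?mulr_gt0//.
by move=> H; lra.
Qed.

End positive_kernels.


(** * Complex expectations of bounded functions *)

Section complex_expectation.
Context {R : realType} d (T : measurableType d) (P : probability T R).
Implicit Types (f g : T -> R[i]).
Local Notation Re := complex.Re.
Local Notation Im := complex.Im.

Definition cexp f : R[i] := (\int[P]_t Re (f t)) +i* (\int[P]_t Im (f t)).

Definition cbounded f := [/\ measurable_fun setT (fun t => Re (f t)),
  measurable_fun setT (fun t => Im (f t)) & exists M, forall t, nsq (f t) <= M].

Lemma cbounded_cst a : cbounded (fun=> a).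
Proof. by split; [exact: measurable_cst..|exists (nsq a)]. Qed.

Lemma cboundedD f g : cbounded f -> cbounded g -> cbounded (fun t => f t + g t).
Proof.
move=> [rf jf [M fM]] [rg jg [N gN]]; split.
- by under eq_fun do rewrite cReD; exact: measurable_funD.
- by under eq_fun do rewrite cImD; exact: measurable_funD.
- exists (2 * M + 2 * N) => t; apply: le_trans (nsqD_le _ _) _.
  by rewrite lerD// ler_pM2l.
Qed.

Lemma cboundedM f g : cbounded f -> cbounded g -> cbounded (fun t => f t * g t).
Proof.
move=> [rf jf [M fM]] [rg jg [N gN]]; split.
- under eq_fun do rewrite cReM.
  by apply: measurable_funB; apply: measurable_funM.
- under eq_fun do rewrite cImM.
  by apply: measurable_funD; apply: measurable_funM.
- exists (M * N) => t; rewrite nsqM.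
  by rewrite ler_pM ?nsq_ge0.
Qed.

Lemma cboundedJ f : cbounded f -> cbounded (fun t => (f t)^*).
Proof.
move=> [rf jf [M fM]]; split.
- by under eq_fun do rewrite cReJ.
- by under eq_fun do rewrite cImJ; exact: measurableT_comp.
- by exists M => t; rewrite nsqJ.
Qed.

Lemma cbounded_sum n (f : 'I_n -> T -> R[i]) :
  (forall i, cbounded (f i)) -> cbounded (fun t => \sum_i f i t).
Proof.
elim: n f => [|n IHn] f bf.
  under eq_fun do rewrite big_ord0.
  exact: cbounded_cst.
under eq_fun do rewrite big_ord_recl.
by apply: cboundedD => //; exact: IHn.
Qed.

Lemma bounded_integrable (f : T -> R) (M : R) : measurable_fun setT f ->
  (forall t, f t ^+ 2 <= M) -> P.-integrable setT (EFin \o f).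
Proof.
move=> mf fM; apply: measurable_bounded_integrable => //.
  by rewrite (le_lt_trans (probability_le1 _ _))// ltry.
exists (M + 1); split; first by rewrite num_real.
move=> x Mx t _ /=; apply: le_trans (ltW Mx); have := fM t.
by rewrite -(real_normK (num_real (f t))); have := normr_ge0 (f t); nra.
Qed.

Lemma cbounded_Re f : cbounded f -> P.-integrable setT (EFin \o (fun t => Re (f t))).
Proof.
move=> [rf jf [M fM]]; apply: (@bounded_integrable _ M) => // t.
by apply: le_trans (fM t); rewrite lerDl sqr_ge0.
Qed.

Lemma cbounded_Im f : cbounded f -> P.-integrable setT (EFin \o (fun t => Im (f t))).
Proof.
move=> [rf jf [M fM]]; apply: (@bounded_integrable _ M) => // t.
by apply: le_trans (fM t); rewrite lerDr sqr_ge0.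
Qed.

Lemma eq_cexp f g : f =1 g -> cexp f = cexp g.
Proof. by move=> fg; congr (_ +i* _); apply: eq_Rintegral => t _; rewrite fg. Qed.

Lemma Rintegral_prob_cst (r : R) : \int[P]_t r = r.
Proof.
rewrite Rintegral_cst// -[RHS]mulr1; congr (_ * _).
exact: (congr1 fine (probability_setT P)).
Qed.

Lemma cexp_cst a : cexp (fun=> a) = a.
Proof.
case: a => a b; rewrite /cexp/=.
by rewrite !Rintegral_prob_cst.
Qed.

Lemma cexpD f g : cbounded f -> cbounded g ->
  cexp (fun t => f t + g t) = cexp f + cexp g.
Proof.
move=> bf bg; apply: complexP; rewrite ?cReD ?cImD /cexp/=.
- under eq_Rintegral do rewrite cReD.
  by rewrite RintegralD//; exact: cbounded_Re.
- under eq_Rintegral do rewrite cImD.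
  by rewrite RintegralD//; exact: cbounded_Im.
Qed.

Lemma scaled_integrable (f : T -> R) (r : R) : P.-integrable setT (EFin \o f) ->
  P.-integrable setT (EFin \o (fun t => r * f t)).
Proof. by move=> /(integrableZl measurableT r). Qed.

Lemma cexpZ a f : cbounded f -> cexp (fun t => a * f t) = a * cexp f.
Proof.
move=> bf; have [rf jf] := (cbounded_Re bf, cbounded_Im bf).
apply: complexP; rewrite ?cReM ?cImM /cexp/=.
- under eq_Rintegral do rewrite cReM.
  by rewrite RintegralB ?RintegralZl//; exact: scaled_integrable.
- under eq_Rintegral do rewrite cImM.
  by rewrite RintegralD ?RintegralZl//; exact: scaled_integrable.
Qed.

Lemma cexp_sum n (f : 'I_n -> T -> R[i]) : (forall i, cbounded (f i)) ->
  cexp (fun t => \sum_i f i t) = \sum_i cexp (f i).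
Proof.
elim: n f => [|n IHn] f bf.
  by rewrite big_ord0 -[RHS]cexp_cst; apply: eq_cexp => t; rewrite big_ord0.
rewrite big_ord_recl -IHn// -cexpD//; last exact: cbounded_sum.
by apply: eq_cexp => t; rewrite big_ord_recl.
Qed.

Lemma cexpJ f : cbounded f -> cexp (fun t => (f t)^*) = (cexp f)^*.
Proof.
move=> bf; apply: complexP; rewrite ?cReJ ?cImJ /cexp/=.
- by apply: eq_Rintegral => t _; rewrite cReJ.
- rewrite -mulN1r -RintegralZl//; last exact: cbounded_Im.
  by apply: eq_Rintegral => t _; rewrite cImJ mulN1r.
Qed.

Lemma cexp_ge0 f : (forall t, 0 <= f t) -> 0 <= cexp f.
Proof.
move=> f0; apply/ge0cP; rewrite /cexp/=; split.
  rewrite -[RHS]Rintegral_prob_cst.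
  by apply: eq_Rintegral => t _; have /ge0cP[] := f0 t.
by apply: Rintegral_ge0 => t _; have /ge0cP[] := f0 t.
Qed.

Lemma Rintegral_bounded_cvg (h_ : nat -> T -> R) (h : T -> R) (M : R) :
  (forall n, measurable_fun setT (h_ n)) -> measurable_fun setT h ->
  (forall n t, `|h_ n t| <= M) ->
  {ae P, forall t, h_ n t @[n --> \oo] --> h t} ->
  \int[P]_t h_ n t @[n --> \oo] --> \int[P]_t h t.
Proof.
move=> mh_ mh hM hcvg.
have [] := @dominated_convergence _ T R P setT measurableT
  (fun n t => (h_ n t)%:E) (fun t => (h t)%:E) (fun=> M%:E).
- by move=> n; exact/measurable_EFinP.
- exact/measurable_EFinP.
- apply: filterS hcvg => t cvt _.
  by apply/fine_cvgP; split => //; near=> n.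
- apply: (@bounded_integrable (fun=> M) (M ^+ 2)) => //.
- by apply: aeW => t n _; rewrite lee_fin.
move=> ih _; rewrite -[X in _ --> X]fineK; last exact: integrable_fin_num.
by move/fine_cvgP => [].
Unshelve. all: by end_near. Qed.

Lemma cexp_affine f g k a b c e : cbounded f -> cbounded g -> cbounded k ->
  cexp (fun t => a * f t + b * g t + c * k t + e) =
  a * cexp f + b * cexp g + c * cexp k + e.
Proof.
move=> bf bg bk; have bZ u h : cbounded h -> cbounded (fun t => u * h t).
  by move=> bh; apply: cboundedM => //; exact: cbounded_cst.
have b1 : cbounded (fun t => a * f t + b * g t) by apply: cboundedD; exact: bZ.
have b2 : cbounded (fun t => a * f t + b * g t + c * k t).
  by apply: cboundedD => //; exact: bZ.
rewrite cexpD ?cexp_cst//; last exact: cbounded_cst.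
rewrite cexpD//; last exact: bZ.
rewrite cexpD; [|exact: bZ..].
by rewrite !cexpZ.
Qed.

Lemma eq_cexp_ae f g : cbounded f -> cbounded g ->
  {ae P, forall t, f t = g t} -> cexp f = cexp g.
Proof.
move=> [rf jf _] [rg jg _] [N [mN N0 subN]].
congr (_ +i* _); congr fine; apply: ae_eq_integral => //.
- exact/measurable_EFinP.
- exact/measurable_EFinP.
- exists N; split => // t /= nfg; apply: subN => /= fg; apply: nfg => _.
  by rewrite fg.
- exact/measurable_EFinP.
- exact/measurable_EFinP.
- exists N; split => // t /= nfg; apply: subN => /= fg; apply: nfg => _.
  by rewrite fg.
Qed.

End complex_expectation.

Lemma Rintegral_distribution (R : realType) d d' (T : measurableType d)
    (T' : measurableType d') (P : probability T R) (X : {mfun T >-> T'})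
    (g : T' -> R) (M : R) : measurable_fun setT g -> (forall t, g t ^+ 2 <= M) ->
  \int[distribution P X]_t g t = \int[P]_t g (X t).
Proof.
move=> mg gM; have mX : measurable_fun setT X by [].
have mgX : measurable_fun setT (g \o X) by exact: measurableT_comp.
have igX : P.-integrable setT (EFin \o (g \o X)).
  by apply: (bounded_integrable P (M := M)) => // t; exact: gM.
rewrite /Rintegral; congr fine.
have := @integral_pushforward _ _ _ _ _ X mX P setT (EFin \o g).
by rewrite preimage_setT; apply => //; exact/measurable_EFinP.
Qed.

Lemma cexp_distribution (R : realType) d d' (T : measurableType d)
    (T' : measurableType d') (P : probability T R) (X : {mfun T >-> T'})
    (f : T' -> R[i]) : cbounded f ->
  cexp (distribution P X) f = cexp P (fun t => f (X t)).
Proof.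
move=> [rf jf [M fM]]; congr (_ +i* _); apply: (@Rintegral_distribution _ _ _ _ _ _ _ _ M) => // t.
- by apply: le_trans (fM t); rewrite lerDl sqr_ge0.
- by apply: le_trans (fM t); rewrite lerDr sqr_ge0.
Qed.

(** * The Pick kernel of a reciprocal Cauchy transform *)

Section cauchy_kernel.
Context {R : realType}.
Local Notation C := R[i].
Local Notation upper := (@upper_half_plane R).
Local Notation Re := complex.Re.
Local Notation Im := complex.Im.
Variable mu : probability (measurableTypeR R) R.
Local Notation E := (cexp mu).
Local Notation G := (cauchy_transform mu).
Local Notation F := (reciprocal_cauchy_transform mu).

Lemma nsq_resolvent (z : C) (t : R) : upper z ->
  nsq (z - t%:C)^-1 <= (Im z ^+ 2)^-1.
Proof.
move=> z0; have z1 : 0 < Im z by [].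
have zt := upper_nsq (upper_sub_real t z0).
rewrite nsqV lef_pV2 ?posrE ?exprn_gt0//.
by rewrite /nsq !ReImE/= oppr0 addr0 lerDr sqr_ge0.
Qed.

Lemma cbounded_resolvent (z : C) : upper z ->
  cbounded (fun t : measurableTypeR R => (z - t%:C)^-1).
Proof.
move=> z0; have z1 : 0 < Im z by [].
have cn : continuous (fun t : R => (nsq (z - t%:C))^-1).
  move=> t; apply: cvgV; first by rewrite gt_eqF// (upper_nsq (upper_sub_real t z0)).
  rewrite /nsq.
  under eq_fun do rewrite !ReImE/= oppr0 addr0.
  rewrite !ReImE/= oppr0 addr0.
  by apply: cvgD; [apply: cvgM; apply: cvgB; (exact: cvg_cst || exact: cvg_id)|exact: cvg_cst].
split; last by exists (Im z ^+ 2)^-1 => t; exact: nsq_resolvent.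
- under eq_fun do rewrite cReV !ReImE/=.
  apply: continuous_measurable_fun => t; apply: cvgM; last exact: cn.
  by apply: cvgB; (exact: cvg_cst || exact: cvg_id).
- under eq_fun do rewrite cImV !ReImE/= oppr0 addr0.
  apply: continuous_measurable_fun => t; apply: cvgN; apply: cvgM; last exact: cn.
  exact: cvg_cst.
Qed.

Lemma Im_cauchy_lt0 (z : C) : upper z -> Im (G z) < 0.
Proof.
move=> z0; have z1 : 0 < Im z by [].
have zt t := upper_nsq (upper_sub_real t z0).
pose f (t : measurableTypeR R) := Im (z - t%:C)^-1.
have f0 t : f t < 0.
  by rewrite /f cImV oppr_lt0 divr_gt0// !ReImE/= oppr0 addr0.
have bf := cbounded_resolvent z0.
have iF : mu.-integrable setT (EFin \o f) by exact: cbounded_Im bf.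
rewrite ltNge; apply/negP => /= Gge0.
have abs0 : (\int[mu]_t `|(f t)%:E| = 0)%E.
  have iN := scaled_integrable (-1) iF.
  rewrite (_ : (fun _ => _) = (fun t => (-1 * f t)%:E)); last first.
    by apply/funext => t /=; rewrite ltr0_norm// mulN1r.
  apply/eqP; rewrite eq_le; apply/andP; split; last first.
    by apply: integral_ge0 => t _; rewrite lee_fin mulN1r oppr_ge0 ltW.
  rewrite -[X in (X <= _)%E]fineK; last exact: integrable_fin_num.
  by rewrite -/(Rintegral _ _ _) RintegralZl// lee_fin mulN1r oppr_le0.
have [/(_ abs0) [N [mN N0 subN]] _] := @ae_eq_integral_abs _ _ _ mu setT
  measurableT (EFin \o f) (measurable_int mu iF).
have : (mu setT <= mu N)%E.
  apply: le_measure; rewrite ?inE// => t _; apply: subN => /= /(_ I)[].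
  by apply/eqP; rewrite lt_eqF.
by rewrite N0 [X in (X <= _)%E]probability_setT lee_fin ler10.
Qed.

Lemma cauchy_neq0 (z : C) : upper z -> G z != 0.
Proof.
by move=> /Im_cauchy_lt0; apply: contraTneq => ->; rewrite ltxx.
Qed.

(* [v z] is the component orthogonal to the constants of the function
   [t |-> F z / (z - t)] of [L^2(mu)], whose mean is 1. *)
Let v (z : C) (t : R) := F z * (z - t%:C)^-1 - 1.

Lemma cbounded_v z : upper z -> cbounded (v z : measurableTypeR R -> C).
Proof.
move=> uz; apply: cboundedD; last exact: cbounded_cst.
by apply: cboundedM; [exact: cbounded_cst|exact: cbounded_resolvent].
Qed.

Definition defect (z : C) := F z - z.

(** This exhibits the Pick kernel of the defect as a Gram matrix in [L^2(mu)]. *)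
Lemma pick_defectE z w : upper z -> upper w ->
  pick defect z w = E (fun t => v z t * (v w t)^*).
Proof.
move=> uz uw; have zw := upper_sub_conj uz uw.
have bz := cbounded_resolvent uz; have bw := cbounded_resolvent uw.
pose a t : C := (z - t%:C)^-1; pose b t : C := (w - t%:C)^-1.
have Gz : E a = G z by [].
have Gw : E b = G w by [].
(* The resolvent identity linearises the product, so that its integral is a
   difference of Cauchy transforms. *)
have ab t : a t * (b t)^* = (z - w^*)^-1 * ((b t)^* - a t).
  rewrite /a /b conjcV conjcB conjcR.
  have := upper_neq0 (upper_sub_real t uz).
  have := upper_neq0 (upper_sub_real t uw).
  rewrite -(conjc_neq0 (w - _)) conjcB conjcR => ? ?.
  by field; apply/and3P.
have Eab : E (fun t => a t * (b t)^*) = (z - w^*)^-1 * ((G w)^* - G z).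
  have d1 : E (fun t => (z - w^*)^-1 * (b t)^* + - (z - w^*)^-1 * a t + 0 * a t + 0) =
      (z - w^*)^-1 * (E b)^* + - (z - w^*)^-1 * E a + 0 * E a + 0.
    by rewrite -cexpJ// cexp_affine//; exact: cboundedJ.
  rewrite -Gw -Gz (_ : _ * (_ - _) = (z - w^*)^-1 * (E b)^* +
    - (z - w^*)^-1 * E a + 0 * E a + 0); last by ring.
  by rewrite -d1; apply: eq_cexp => t; rewrite ab; ring.
have -> : E (fun t => v z t * (v w t)^*) =
    F z * (F w)^* * E (fun t => a t * (b t)^*) + (- F z) * E a
    + (- (F w)^*) * (E b)^* + 1.
  rewrite -cexpJ// -cexp_affine//; last 2 first.
  - by apply: cboundedM => //; exact: cboundedJ.
  - exact: cboundedJ.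
  apply: eq_cexp => t; rewrite /v -/(a t) -/(b t) conjcB conjcM conjc1.
  by ring.
rewrite Eab Gz Gw /pick /defect conjcB.
have Fz : G z = (F z)^-1 by rewrite /F invrK.
have Fw : G w = (F w)^-1 by rewrite /F invrK.
have Fz0 : F z != 0 by rewrite invr_eq0 cauchy_neq0.
have Fw0 : (F w)^* != 0 by rewrite conjc_neq0 invr_eq0 cauchy_neq0.
rewrite Fz Fw conjcV; field.
by apply/and3P.
Qed.

(** For each [t] the integrand is the quadratic form of [M] at the vector
    [x i * v (w i) t], hence nonnegative. *)
Lemma pick_multiplier_defect : pick_multiplier defect.
Proof.
move=> n w uw M pM x.
have bij i j : cbounded (fun t : measurableTypeR R =>
    x i * (x j)^* * M i j * (v (w i) t * (v (w j) t)^*)).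
  apply: cboundedM; first exact: cbounded_cst.
  by apply: cboundedM; [exact: cbounded_v|apply/cboundedJ/cbounded_v].
rewrite (_ : \sum_i _ = E (fun t => \sum_i \sum_j
    x i * (x j)^* * M i j * (v (w i) t * (v (w j) t)^*))).
  apply: cexp_ge0 => t; have := pM (fun i => x i * v (w i) t).
  congr (_ <= _); apply: eq_bigr => i _; apply: eq_bigr => j _.
  by rewrite conjcM; ring.
rewrite cexp_sum; last by move=> i; apply: cbounded_sum.
apply: eq_bigr => i _; rewrite cexp_sum//; apply: eq_bigr => j _.
rewrite cexpZ -?pick_defectE//; last first.
  by apply: cboundedM; [exact: cbounded_v|apply/cboundedJ/cbounded_v].
by ring.
Qed.

Local Notation iy n := (0 +i* n%:R : C).

Lemma cauchy_iy_cvg : Re (iy n * G (iy n)) @[n --> \oo] --> (1 : R) /\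
  Im (iy n * G (iy n)) @[n --> \oo] --> (0 : R).
Proof.
pose f n (t : measurableTypeR R) : C := iy n * (iy n - t%:C)^-1.
have fE n t : (0 < n)%N -> f n t =
    (n%:R ^+ 2 / (n%:R ^+ 2 + t ^+ 2)) +i* (- (n%:R * t / (n%:R ^+ 2 + t ^+ 2))).
  move=> n0; have : (0 : R) < n%:R ^+ 2 + t ^+ 2.
    by rewrite ltr_pwDl ?sqr_ge0// exprn_gt0// ltr0n.
  move=> d0; apply: complexP; rewrite !(cReV, cImV, ReImE)/= /nsq !ReImE/=;
    by field; rewrite gt_eqF.
have ub n : (0 < n)%N -> upper (iy n) by rewrite /upper_half_plane/= ltr0n.
have bf n : (0 < n)%N -> cbounded (f n).
  move=> n0; apply: cboundedM; first exact: cbounded_cst.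
  by apply: cbounded_resolvent; exact: ub.
have EG n : (0 < n)%N -> iy n * G (iy n) = E (f n).
  by move=> n0; rewrite cexpZ//; exact/cbounded_resolvent/ub.
have f1 n t : (0 < n)%N -> nsq (f n t) <= 1 ^+ 2.
  move=> n0; have n1 : (0 : R) < n%:R by rewrite ltr0n.
  rewrite /f nsqM (le_trans (ler_wpM2l (nsq_ge0 _) (nsq_resolvent _ (ub _ n0))))//=.
  by rewrite /nsq/= expr0n add0r mulfV ?expr1n// sqrf_eq0 gt_eqF.
have u0 : (n.+1%:R^-1 : R) @[n --> \oo] --> 0 := cvg_harmonic.
have dE t : (1 + (t * n.+1%:R^-1) ^+ 2 : R)^-1 @[n --> \oo] --> (1 : R).
  rewrite -[X in _ --> X]invr1; apply: cvgV; first exact: oner_neq0.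
  rewrite -[X in _ --> X]addr0; apply: cvgD; first exact: cvg_cst.
  rewrite [X in _ --> X](_ : 0 = (t * 0) * (t * 0)); last by ring.
  by apply: cvgM; apply: cvgM => //; exact: cvg_cst.
split.
- rewrite -[X in _ --> X](@Rintegral_prob_cst _ _ _ mu 1); rewrite -cvg_shiftS.
  apply: (@cvg_trans _ (Re (E (f n.+1)) @[n --> \oo])).
    apply: near_eq_cvg; apply: nearW => n.
    exact: (congr1 (@complex.Re R) (esym (EG n.+1 isT))).
  apply: (@Rintegral_bounded_cvg _ _ _ _ (fun n t => Re (f n.+1 t)) (fun=> 1) 1).
  + by move=> n; have [] := bf n.+1 isT.
  + exact: measurable_cst.
  + by move=> n t; apply: Re_le_nsq => //; exact: f1.
  + apply: aeW => t; apply: cvg_trans (dE t); apply: near_eq_cvg; apply: nearW => n.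
    have n0 : (0 : R) < n.+1%:R by rewrite ltr0n.
    rewrite fE//=; field; rewrite !gt_eqF//.
    by rewrite ltr_pwDl ?sqr_ge0// exprn_gt0.
- rewrite -[X in _ --> X](@Rintegral_prob_cst _ _ _ mu 0); rewrite -cvg_shiftS.
  apply: (@cvg_trans _ (Im (E (f n.+1)) @[n --> \oo])).
    apply: near_eq_cvg; apply: nearW => n.
    exact: (congr1 (@complex.Im R) (esym (EG n.+1 isT))).
  apply: (@Rintegral_bounded_cvg _ _ _ _ (fun n t => Im (f n.+1 t)) (fun=> 0) 1).
  + by move=> n; have [] := bf n.+1 isT.
  + exact: measurable_cst.
  + by move=> n t; apply: Im_le_nsq => //; exact: f1.
  + apply: aeW => t.
    have : - (t * n.+1%:R^-1 / (1 + (t * n.+1%:R^-1) ^+ 2)) @[n --> \oo] --> (0 : R).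
      rewrite -[X in _ --> X]oppr0 -(mul0r 1); apply: cvgN; apply: cvgM (dE t).
      by rewrite -(mulr0 t); apply: cvgM => //; exact: cvg_cst.
    apply: cvg_trans; apply: near_eq_cvg; apply: nearW => n.
    have n0 : (0 : R) < n.+1%:R by rewrite ltr0n.
    rewrite fE//=; field; rewrite !gt_eqF//.
    by rewrite ltr_pwDl ?sqr_ge0// exprn_gt0.
Qed.

(** From [cauchy_iy_cvg], since [F z - z = z * (1 - z * G z) / (z * G z)]. *)
Lemma defect_iy_small (e : R) : 0 < e ->
  \forall n \near \oo, nsq (defect (iy n)) <= e * n%:R ^+ 2.
Proof.
move=> e0.
have [c1 c2] := cauchy_iy_cvg.
have nc : nsq (iy n * G (iy n)) @[n --> \oo] --> (1 : R).
  rewrite [X in _ --> X](_ : 1 = 1 * 1 + 0 * 0 :> R); last by ring.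
  under eq_fun do rewrite /nsq !expr2.
  by apply: cvgD; apply: cvgM.
have dc : nsq (1 - iy n * G (iy n)) / nsq (iy n * G (iy n)) @[n --> \oo] --> (0 : R).
  rewrite [X in _ --> X](_ : 0 = ((1 - 1) * (1 - 1) + (0 - 0) * (0 - 0)) / 1 :> R); last by ring.
  apply: cvgM; last by apply: cvgV => //; exact: oner_neq0.
  under eq_fun do rewrite /nsq !expr2 !cReD !cImD !cReN !cImN.
  by apply: cvgD; apply: cvgM; apply: cvgB => //; exact: cvg_cst.
near=> n.
have n0 : (0 < n)%N by near: n; exact: nbhs_infty_gt.
have nle : `|nsq (1 - iy n * G (iy n)) / nsq (iy n * G (iy n))| <= e.
  by near: n; exact: (cvgr0_norm_le _ dc _ e0).
have n1 : (0 : R) < n%:R by rewrite ltr0n.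
have un : upper (iy n) by rewrite /upper_half_plane/=.
have G0 := cauchy_neq0 un.
have i0 := upper_neq0 un.
have -> : defect (iy n) = iy n * (1 - iy n * G (iy n)) / (iy n * G (iy n)).
  by rewrite /defect /reciprocal_cauchy_transform; field; apply/andP.
rewrite 2!nsqM nsqV -mulrA mulrC.
have -> : nsq (iy n) = n%:R ^+ 2 by rewrite /nsq/= expr0n add0r.
rewrite ler_wpM2r ?sqr_ge0//.
exact: le_trans (ler_norm _) nle.
Unshelve. all: by end_near. Qed.

End cauchy_kernel.


(** * Fixed points of compositions of shifts by Pick functions *)

Lemma cvg_geometric_increments (R : realType) (x : nat -> R) (A s : R) :
  0 <= s < 1 -> (forall n, `|x n.+1 - x n| <= A * s ^+ n) -> cvgn x.
Proof.
move=> /andP[s0 s1] xA.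
have : cvgn (series (telescope x)).
  apply: normed_cvg; apply: (series_le_cvg (v_ := geometric A s)).
  - by move=> n; exact: normr_ge0.
  - by move=> n; apply: le_trans (xA n); exact: normr_ge0.
  - exact: xA.
  - by apply: is_cvg_geometric_series; rewrite ger0_norm.
move=> cx; rewrite (_ : x = (fun n => x 0%N + series (telescope x) n)).
  by apply: is_cvgD => //; exact: is_cvg_cst.
by apply/funext => n; exact: eq_sum_telescope.
Qed.

Section hyperbolic_fixed_point.
Context {R : realType}.
Local Notation C := R[i].
Local Notation upper := (@upper_half_plane R).
Local Notation Re := complex.Re.
Local Notation Im := complex.Im.
Implicit Types (z w u : C) (h : C -> C).

(** Convergence in [R[i]], stated in [R]. *)
Definition ccvg (a : nat -> C) (w : C) := nsq (a n - w) @[n --> \oo] --> (0 : R).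

Lemma ccvg_Re a w : ccvg a w -> Re (a n) @[n --> \oo] --> Re w.
Proof.
move=> aw; apply/cvgrPdist_le => /= e e0.
near=> n; rewrite distrC -cReN -cReD; apply: Re_le_nsq; first exact: ltW.
apply: (le_trans (ler_norm _)); near: n.
by apply: (cvgr0_norm_le _ aw); rewrite exprn_gt0.
Unshelve. all: by end_near. Qed.

Lemma ccvg_Im a w : ccvg a w -> Im (a n) @[n --> \oo] --> Im w.
Proof.
move=> aw; apply/cvgrPdist_le => /= e e0.
near=> n; rewrite distrC -cImN -cImD; apply: Im_le_nsq; first exact: ltW.
apply: (le_trans (ler_norm _)); near: n.
by apply: (cvgr0_norm_le _ aw); rewrite exprn_gt0.
Unshelve. all: by end_near. Qed.

Lemma Re_Im_ccvg a w : Re (a n) @[n --> \oo] --> Re w ->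
  Im (a n) @[n --> \oo] --> Im w -> ccvg a w.
Proof.
move=> ra ia; rewrite /ccvg.
rewrite [X in _ --> X](_ : 0 = (Re w - Re w) * (Re w - Re w) +
  (Im w - Im w) * (Im w - Im w) :> R); last by ring.
under eq_fun do rewrite /nsq !expr2 !cReD !cImD !cReN !cImN.
by apply: cvgD; apply: cvgM; apply: cvgB => //; exact: cvg_cst.
Qed.

Lemma ccvg_nsq a w c : ccvg a w -> nsq (a n - c) @[n --> \oo] --> nsq (w - c).
Proof.
move=> aw; have [cr ci] := (ccvg_Re aw, ccvg_Im aw).
rewrite [X in _ --> X](_ : _ = (Re w - Re c) * (Re w - Re c) +
  (Im w - Im c) * (Im w - Im c)); last by rewrite /nsq !ReImE; ring.
under eq_fun do rewrite /nsq !expr2 !cReD !cImD !cReN !cImN.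
by apply: cvgD; apply: cvgM; apply: cvgB => //; exact: cvg_cst.
Qed.

Lemma ccvg_unique a w w' : ccvg a w -> ccvg a w' -> w = w'.
Proof.
move=> aw aw'; apply: complexP.
- exact: (cvg_unique _ (ccvg_Re aw) (ccvg_Re aw')).
- exact: (cvg_unique _ (ccvg_Im aw) (ccvg_Im aw')).
Qed.

Lemma ccvg_shift a w : ccvg a w -> ccvg (fun n => a n.+1) w.
Proof. by rewrite /ccvg -(cvg_shiftS (fun n => nsq (a n - w))). Qed.

Lemma ccvg_geometric (a : nat -> C) (A s : R) : 0 <= s < 1 -> 0 <= A ->
  (forall n, nsq (a n.+1 - a n) <= (A * s ^+ n) ^+ 2) -> exists w, ccvg a w.
Proof.
move=> s01 A0 aA; have /andP[s0 _] := s01.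
have As n : 0 <= A * s ^+ n by rewrite mulr_ge0// exprn_ge0.
have cr : cvgn (fun n => Re (a n)).
  apply: (cvg_geometric_increments s01 (A := A)) => n.
  by rewrite -cReN -cReD; exact: Re_le_nsq.
have ci : cvgn (fun n => Im (a n)).
  apply: (cvg_geometric_increments s01 (A := A)) => n.
  by rewrite -cImN -cImD; exact: Im_le_nsq.
by exists (limn (fun n => Re (a n)) +i* limn (fun n => Im (a n))); exact: Re_Im_ccvg.
Qed.

(** With [d] the hyperbolic distance of the upper half-plane, this is
    [2 * cosh d - 2]. *)
Definition hdist z w := nsq (z - w) / (Im z * Im w).

Lemma hdist_ge0 z w : upper z -> upper w -> 0 <= hdist z w.
Proof. by move=> z0 w0; rewrite divr_ge0 ?nsq_ge0// ltW// mulr_gt0. Qed.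

Lemma hdist0_eq z w : upper z -> upper w -> hdist z w <= 0 -> z = w.
Proof.
move=> z0 w0; rewrite /hdist pmulr_lle0 ?invr_gt0 ?mulr_gt0//.
move=> H; apply/eqP; rewrite -subr_eq0 -nsq_eq0 eq_le nsq_ge0 andbT//.
Qed.

(** Schwarz-Pick makes [h] nonexpanding, and adding [z] moves the images away from
    the real axis. It is enough to control [Im h] at one of the two points. *)
Lemma hdist_shift_le h z w w' (B : R) : pick_positive h ->
  upper z -> upper w -> upper w' -> Im (h w) <= B ->
  hdist (z + h w) (z + h w') <= B / (B + Im z) * hdist w w'.
Proof.
move=> ph z0 w0 w0' hB.
have [y0 x0 x0'] : [/\ 0 < Im z, 0 < Im w & 0 < Im w'] by [].
have H0 := pick_Im_ge0 ph w0; have H0' := pick_Im_ge0 ph w0'.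
have SP := schwarz_pick ph w0 w0'.
rewrite /hdist !cImD (_ : z + h w - (z + h w') = h w - h w'); last by ring.
have B0 := le_trans H0 hB.
have ya : 0 < Im z + Im (h w) by rewrite ltr_pwDl.
have yb : 0 < Im z + Im (h w') by rewrite ltr_pwDl.
have yB : 0 < B + Im z by rewrite ltr_wpDl.
set S := nsq (w - w') / _.
have S0 : 0 <= S by rewrite divr_ge0 ?nsq_ge0// mulr_ge0// ltW.
have N1 : nsq (h w - h w') <= S * (Im (h w) * Im (h w')).
  by rewrite /S mulrAC ler_pdivlMr ?mulr_gt0.
apply: (@le_trans _ _ (S * (Im (h w) * Im (h w')) /
    ((Im z + Im (h w)) * (Im z + Im (h w'))))).
  by rewrite ler_wpM2r// invr_ge0 mulr_ge0// ltW.
rewrite -mulrA -mulf_div mulrC; apply: ler_wpM2r => //.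
rewrite -[X in _ <= X]mulr1; apply: ler_pM.
- by rewrite divr_ge0// ltW.
- by rewrite divr_ge0// ltW.
- rewrite ler_pdivrMr// mulrAC ler_pdivlMr//.
  by have := mulr_ge0 (ltW y0) (_ : 0 <= B - Im (h w)); rewrite subr_ge0 => /(_ hB); lra.
- by rewrite ler_pdivrMr// mul1r lerDr ltW.
Qed.

Lemma ratio_lt1 (a y : R) : 0 <= a -> 0 < y -> 0 <= a / (a + y) < 1.
Proof.
move=> a0 y0; have ay : 0 < a + y by rewrite ltr_wpDl.
by rewrite divr_ge0// ?ltW//= ltr_pdivrMr// mul1r ltrDl.
Qed.

Lemma shift_fixpoint_unique h1 h2 z w w' : pick_positive h1 -> pick_positive h2 ->
  upper z -> upper w -> upper w' ->
  w = z + h2 (z + h1 w) -> w' = z + h2 (z + h1 w') -> w = w'.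
Proof.
move=> p1 p2 z0 w0 w0' ew ew'; apply: hdist0_eq => //.
have u0 := upperD z0 (pick_Im_ge0 p1 w0).
have u0' := upperD z0 (pick_Im_ge0 p1 w0').
have := hdist_shift_le p1 z0 w0 w0' (lexx _).
have := hdist_shift_le p2 z0 u0 u0' (lexx _).
rewrite -ew -ew'.
set k1 := Im (h1 w) / (Im (h1 w) + Im z).
set k2 := Im (h2 _) / (Im (h2 _) + Im z) => d2 d1.
have y0 : 0 < Im z := z0.
have /andP[k10 k11] : 0 <= k1 < 1 by apply: ratio_lt1 => //; exact: pick_Im_ge0.
have /andP[k20 k21] : 0 <= k2 < 1 by apply: ratio_lt1 => //; exact: pick_Im_ge0.
have := hdist_ge0 w0 w0'.
have := hdist_ge0 u0 u0'.
set du := hdist _ _ in d1 d2 *; set dw := hdist w w' in d1 d2 * => du0 dw0.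
have duw : du <= dw by apply: (le_trans d1); rewrite ler_piMl// ltW.
have : dw <= k2 * dw by apply: (le_trans d2); exact: ler_wpM2l.
move=> H; have {}H : (1 - k2) * dw <= 0 by lra.
by rewrite pmulr_rle0 ?subr_gt0 in H.
Qed.

(** These are hyperbolic disks centred on the imaginary axis: up to an additive
    constant, the quotient [nsq (w - ir) / Im w] is a multiple of the hyperbolic
    cosine of the distance from [ir] to [w]. *)
Definition disk (r M : R) w := nsq (w - (0 +i* r)) <= M * Im w.

(** Schwarz-Pick between [w] and [ir] bounds [nsq (h w - h (ir))] by
    [M / 8 * Im (h w)], because [Im h (ir) <= r / 8] gains the factor [1 / 8]. The
    hypothesis on [M] absorbs the distance from [ir] to its own image. *)
Lemma disk_shift h z (r M : R) w : pick_positive h -> 0 < r -> 0 <= M ->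
  upper z -> upper w -> Im (h (0 +i* r)) <= r / 8 ->
  8 / 3 * nsq (z + h (0 +i* r) - (0 +i* r)) <= M * Im z ->
  disk r M w -> disk r M (z + h w).
Proof.
move=> ph r0 M0 z0 w0 hr zM wM; rewrite /disk.
have y0 : 0 < Im z := z0.
have x0 : 0 < Im w := w0.
have ir0 : upper (0 +i* r) by [].
have H := pick_Im_ge0 ph w0.
have SP := schwarz_pick ph w0 ir0; rewrite /= in SP.
have key : nsq (h w - h (0 +i* r)) <= M / 8 * Im (h w).
  rewrite -(ler_pM2r (mulr_gt0 x0 r0)); apply: (le_trans SP).
  apply: (@le_trans _ _ (M * Im w * (Im (h w) * (r / 8)))); last first.
    by rewrite le_eqVlt; apply/orP; left; apply/eqP; field.
  apply: ler_pM => //; first exact: nsq_ge0.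
    by rewrite mulr_ge0// pick_Im_ge0.
  exact: ler_wpM2l.
rewrite (_ : z + h w - _ = (h w - h (0 +i* r)) + (z + h (0 +i* r) - (0 +i* r)));
  last by ring.
apply: (le_trans (nsqD_le _ _)); rewrite cImD.
have := mulr_ge0 M0 H.
have := mulr_ge0 M0 (ltW y0); by lra.
Qed.

Lemma disk_Im_le (r M : R) w : 0 < r -> 0 <= M -> disk r M w -> Im w <= 2 * r + M.
Proof.
move=> r0 M0; rewrite /disk /nsq !cReD !cImD !cReN !cImN/= => H.
rewrite leNgt; apply/negP => K.
have := sqr_ge0 (Re w - 0).
nra.
Qed.

(** The disk is invariant and bounded, so both shifts contract by a common factor
    [k < 1] on its part above [Im z], and the iteration from [z] converges
    geometrically. *)
Lemma shift_fixpoint h1 h2 z (r M : R) : pick_positive h1 -> pick_positive h2 ->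
  upper z -> 0 < r -> 0 <= M ->
  Im (h1 (0 +i* r)) <= r / 8 -> Im (h2 (0 +i* r)) <= r / 8 ->
  8 / 3 * nsq (z + h1 (0 +i* r) - (0 +i* r)) <= M * Im z ->
  8 / 3 * nsq (z + h2 (0 +i* r) - (0 +i* r)) <= M * Im z ->
  disk r M z ->
  exists w, [/\ upper w, w = z + h2 (z + h1 w), disk r M w &
    ccvg (fun n => iter n (fun w => z + h2 (z + h1 w)) z) w].
Proof.
move=> p1 p2 z0 r0 M0 hr1 hr2 zM1 zM2 zM.
have y0 : 0 < Im z := z0.
pose T w := z + h2 (z + h1 w); pose a n := iter n T z.
(* [B] bounds the imaginary parts on the disk. *)
pose B := 2 * r + M; pose k := B / (B + Im z).
have B0 : 0 < B by rewrite /B ltr_pwDl// mulr_gt0.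
have k01 : 0 <= k < 1 by apply: ratio_lt1 => //; exact: ltW.
have /andP[k0 k1] := k01.
have shift h w : pick_positive h -> Im (h (0 +i* r)) <= r / 8 ->
    8 / 3 * nsq (z + h (0 +i* r) - (0 +i* r)) <= M * Im z ->
    Im z <= Im w -> disk r M w ->
    [/\ Im z <= Im (z + h w), disk r M (z + h w) & Im (h w) <= B].
  move=> ph hr hM wz wM; have w0 : upper w by exact: lt_le_trans wz.
  have dw := disk_shift ph r0 M0 z0 w0 hr hM wM.
  rewrite cImD lerDl pick_Im_ge0//; split => //.
  by have := disk_Im_le r0 M0 dw; rewrite cImD; apply: le_trans; rewrite lerDr ltW.
have up w : Im z <= Im w -> upper w by exact: lt_le_trans.
have aP n : Im z <= Im (a n) /\ disk r M (a n).
  elim: n => [|n [IH1 IH2]]; first by [].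
  have [K1 K2 _] := shift h1 _ p1 hr1 zM1 IH1 IH2.
  by have [K3 K4 _] := shift h2 _ p2 hr2 zM2 K1 K2.
have hT w w' : Im z <= Im w -> disk r M w -> Im z <= Im w' -> disk r M w' ->
    hdist (T w) (T w') <= k * hdist w w'.
  move=> wz wM wz' wM'.
  have [K1 K2 K3] := shift h1 _ p1 hr1 zM1 wz wM.
  have [K1' K2' K3'] := shift h1 _ p1 hr1 zM1 wz' wM'.
  have [L1 L2 L3] := shift h2 _ p2 hr2 zM2 K1 K2.
  have d1 := hdist_shift_le p1 z0 (up _ wz) (up _ wz') K3.
  have d2 := hdist_shift_le p2 z0 (up _ K1) (up _ K1') L3.
  have := hdist_ge0 (up _ wz) (up _ wz').
  have := hdist_ge0 (up _ K1) (up _ K1').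
  rewrite -/k in d1 d2; rewrite -/(T w) -/(T w') in d2.
  by nra.
pose D := hdist (a 1%N) (a 0%N).
have D0 : 0 <= D by apply: hdist_ge0; apply: up; apply: (aP _).1.
have dD n : hdist (a n.+1) (a n) <= D * k ^+ n.
  elim: n => [|n IH]; first by rewrite expr0 mulr1.
  have [? ?] := aP n; have [? ?] := aP n.+1.
  rewrite exprS mulrCA; apply: le_trans (hT _ _ _ _ _ _) _ => //.
  exact: ler_wpM2l.
have [w aw] : exists w, ccvg a w.
  apply: (@ccvg_geometric _ (B * Num.sqrt D) (Num.sqrt k)).
  - rewrite sqrtr_ge0/= -sqrtr1 ltr_sqrt//.
  - by rewrite mulr_ge0 ?sqrtr_ge0// ltW.
  - move=> n; rewrite !exprMn sqr_sqrtr// exprAC sqr_sqrtr//.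
    have [i1 d1] := aP n.+1; have [i0 d0] := aP n.
    have := dD n; rewrite /hdist ler_pdivrMr; last first.
      by rewrite mulr_gt0//; apply: lt_le_trans y0 _.
    move/le_trans; apply.
    rewrite [X in _ <= X](_ : _ = D * k ^+ n * (B * B)); last by ring.
    apply: ler_wpM2l; first exact: mulr_ge0 D0 (exprn_ge0 _ k0).
        apply: ler_pM; rewrite ?(le_trans (ltW y0))//; exact: disk_Im_le.
have wz : Im z <= Im w.
  apply: (cvgr_to_ge (ccvg_Im aw)); apply: nearW => n; exact: (aP n).1.
have wM : disk r M w.
  rewrite /disk -subr_ge0.
  have c : M * Im (a n) - nsq (a n - (0 +i* r)) @[n --> \oo] -->
      M * Im w - nsq (w - (0 +i* r)).
    apply: cvgB; last exact: ccvg_nsq.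
    by apply: cvgM; [exact: cvg_cst|exact: ccvg_Im].
  by apply: (cvgr_to_ge c); apply: nearW => n; rewrite subr_ge0; exact: (aP n).2.
have Taw : ccvg (fun n => T (a n)) (T w).
  rewrite /ccvg; apply: (@squeeze_cvgr _ _ _ _ (fun=> 0)
    (fun n => B ^+ 2 * k * (nsq (a n - w) / (Im z ^+ 2)))).
  - apply: nearW => n; rewrite nsq_ge0/=.
    have [i1 d1] := aP n; have [i2 d2] := aP n.+1.
    have [K1 K2 _] := shift h1 _ p1 hr1 zM1 wz wM.
    have [K3 K4 _] := shift h2 _ p2 hr2 zM2 K1 K2.
    have := hT _ _ i1 d1 wz wM.
    rewrite {1}/hdist ler_pdivrMr; last first.
      by rewrite mulr_gt0//; exact: lt_le_trans y0 _.
    move/le_trans; apply.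
    rewrite [X in _ <= X](_ : _ = k * (nsq (a n - w) / Im z ^+ 2) * (B * B)); last by ring.
    have hd0 : 0 <= hdist (a n) w by apply: hdist_ge0; exact: up.
    have y1 : 0 <= Im z := ltW y0.
    apply: ler_pM; [exact: mulr_ge0|by rewrite mulr_ge0// (le_trans y1)| |].
    + rewrite ler_wpM2l// ler_wpM2l ?nsq_ge0// lef_pV2 ?posrE ?exprn_gt0//.
        by rewrite expr2; exact: ler_pM.
      by rewrite mulr_gt0//; exact: lt_le_trans y0 _.
    + apply: ler_pM; [exact: le_trans i2|exact: le_trans K3| |]; exact: disk_Im_le.
  - exact: cvg_cst.
  - rewrite -(mulr0 (B ^+ 2 * k)); apply: cvgM; first exact: cvg_cst.
    by rewrite -(mul0r (Im z ^+ 2)^-1); apply: cvgM => //; exact: cvg_cst.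
exists w; split => //; first exact: up.
exact: ccvg_unique (ccvg_shift aw) Taw.
Qed.

End hyperbolic_fixed_point.


(** * Interpolation at finitely many points by a discrete measure *)

Section finite_interpolation.
Local Open Scope sesquilinear_scope.
Variable C : numClosedFieldType.

Lemma adjmxM m n p (A : 'M[C]_(m, n)) (B : 'M[C]_(n, p)) :
  (A *m B)^t* = B^t* *m A^t*.
Proof. by rewrite trmx_mul map_mxM. Qed.

Lemma adjmxB m n (A B : 'M[C]_(m, n)) : (A - B)^t* = A^t* - B^t*.
Proof. by rewrite linearB/= map_mxB. Qed.

Lemma hermitian_spectral n (A : 'M[C]_n) : A^t* = A ->
  exists P : 'M[C]_n, exists d : 'rV[C]_n,
  [/\ P *m P^t* = 1%:M, P^t* *m P = 1%:M, A = P^t* *m diag_mx d *m P &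
     forall k, d 0 k \is Num.real].
Proof.
move=> hA; have herm : A \is hermsymmx.
  by apply/is_hermitianmxP; rewrite expr0 scale1r hA.
have /hermitian_normalmx/orthomx_spectralP AE := herm.
have /mxOverP rd := hermitian_spectral_diag_real herm.
exists (spectralmx A), (spectral_diag A).
have U := spectral_unitarymx A.
have UU : spectralmx A *m (spectralmx A)^t* = 1%:M by exact/unitarymxP.
split => //; first exact: mulmx1C.
by rewrite -invmx_unitary.
Qed.

(* [K] is the Pick matrix of [-g]. The matrix [K - G *m G^t*] is its Schur
   complement in the matrix bordered by [G] and 1. *)
Variables (n : nat) (K : 'M[C]_n) (z g : 'I_n -> C).
Hypothesis z_nonreal : forall i j, z i - (z j)^* != 0.
Hypothesis KE : forall i j, (z i - (z j)^*) * K i j = (g j)^* - g i.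
Hypothesis psdK : forall x : 'rV[C]_n,
  0 <= (x *m (K - (\col_i g i) *m (\col_i g i)^t*) *m x^t*) 0 0.

Let G : 'cV[C]_n := \col_i g i.
Let one : 'cV[C]_n := const_mx 1.
Let D : 'M[C]_n := diag_mx (\row_i z i).

Let hermK : K^t* = K.
Proof.
apply/matrixP => i j; rewrite !mxE.
apply: (mulfI (z_nonreal i j)); rewrite KE.
have := congr1 (@Num.conj C) (KE j i).
rewrite rmorphM !rmorphB/= !conjCK -(opprB (z i)) mulNr => /eqP.
by rewrite eqr_oppLR opprB => /eqP.
Qed.

Let displacement : D *m K - one *m G^t* = K *m D^t* - G *m one^t*.
Proof.
apply/matrixP => i j.
rewrite /D mul_diag_mx tr_diag_mx map_diag_mx mul_mx_diag !mxE !big_ord1 !mxE.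
rewrite mul1r rmorph1 mulr1; apply/eqP.
rewrite subr_eq -addrA [- _ + _]addrC -KE mulrBl addrCA [_ * K i j in X in _ + X]mulrC.
by rewrite subrr addr0.
Qed.

Lemma form_ge0 m (x : 'rV[C]_m) : 0 <= (x *m x^t*) 0 0.
Proof. by rewrite !mxE sumr_ge0// => i _; rewrite !mxE mul_conjC_ge0. Qed.

Let psdK0 (x : 'rV[C]_n) : 0 <= (x *m K *m x^t*) 0 0.
Proof.
have -> : x *m K *m x^t* =
    x *m (K - G *m G^t*) *m x^t* + (x *m G) *m (x *m G)^t*.
  by rewrite adjmxM mulmxBr mulmxBl !mulmxA subrK.
by rewrite mxE addr_ge0// form_ge0.
Qed.

(** The resolvent model in dimension [n]. If [g] were the function
    [z |-> xi^* (z - A)^-1 xi], the vectors [xi^* (z_i - A)^-1] would have Gram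
    matrix [K]. Conversely take the rows of [B = K^(1/2)] as these vectors: with
    [Bp] the pseudo-inverse of [B], the matrix [A = Bp (D K - 1 G^* ) Bp] is
    Hermitian by the displacement identity, and it satisfies [B A = D B - 1 xi^*]
    for [xi = Bp G]. Diagonalising [A] gives the atoms and their masses, of total
    [xi^* xi <= 1]. *)
Theorem finite_interpolation : exists (a p : 'I_n -> C),
  [/\ forall k, a k \is Num.real, forall k, 0 <= p k, \sum_k p k <= 1 &
      forall i, g i = \sum_k p k / (z i - a k)].
Proof.
have [P [d [PP PP' KP rd]]] := hermitian_spectral hermK.
have d0 k : 0 <= d 0 k.
  have := psdK0 (delta_mx 0 k *m P).
  rewrite KP adjmxM !mulmxA -(mulmxA _ P (P^t*)) PP mulmx1.
  rewrite -(mulmxA _ P (P^t*)) PP mulmx1 -rowE trmx_delta map_delta_mx -colE.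
  by rewrite !mxE eqxx mulr1n.
(* Functional calculus of [K]; as [0^-1 = 0], inverting eigenvalues yields the
   pseudo-inverse. *)
pose f (phi : 'I_n -> C) := P^t* *m diag_mx (\row_k phi k) *m P.
have fM phi psi : f phi *m f psi = f (fun k => phi k * psi k).
  rewrite /f !mulmxA -(mulmxA _ P (P^t*)) PP mulmx1 -(mulmxA (P^t*)) mulmx_diag.
  by congr (_ *m diag_mx _ *m _); apply/rowP => k; rewrite !mxE.
have fJ phi : (forall k, (phi k)^* = phi k) -> (f phi)^t* = f phi.
  move=> pJ; rewrite /f !adjmxM trmxCK tr_diag_mx map_diag_mx mulmxA.
  by congr (_ *m diag_mx _ *m _); apply/rowP => k; rewrite !mxE /= pJ.
have feq phi psi : phi =1 psi -> f phi = f psi.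
  by move=> e; congr (_ *m diag_mx _ *m _); apply/rowP => k; rewrite !mxE e.
pose s k := sqrtC (d 0 k).
have s0 k : 0 <= s k by rewrite sqrtC_ge0.
have sJ k : (s k)^* = s k by apply/CrealP; exact: ger0_real.
have sVJ k : ((s k)^-1)^* = (s k)^-1 by rewrite fmorphV/= sJ.
pose B := f s; pose Bp := f (fun k => (s k)^-1).
have sK k : s k * (s k)^-1 * s k = s k.
  by have [->|s1] := eqVneq (s k) 0; rewrite ?mulr0// mulfV// mul1r.
have KB : K = B *m B.
  rewrite /B fM KP /f; congr (_ *m diag_mx _ *m _); apply/rowP => k.
  by rewrite !mxE -expr2 sqrtCK.
have BBpB : B *m Bp *m B = B by rewrite /B /Bp !fM; exact: feq.
have BpB : Bp *m B = B *m Bp by rewrite /B /Bp !fM; apply: feq => k; exact: mulrC.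
have PiBp : B *m Bp *m Bp = Bp.
  rewrite /B /Bp !fM; apply: feq => k.
  have [->|s1] := eqVneq (s k) 0; first by rewrite invr0 !mulr0.
  by rewrite mulfV// mul1r.
have hB : B^t* = B by exact: fJ.
have hBp : Bp^t* = Bp by exact: fJ.
have BpK : Bp *m Bp *m K *m Bp *m Bp = Bp *m Bp.
  rewrite KB mulmxA /B /Bp !fM; apply: feq => k.
  have [->|s1] := eqVneq (s k) 0; first by rewrite invr0 !mulr0.
  by field.
clearbody B Bp; have [Pi PiE] : exists Pi, Pi = B *m Bp by eexists.
have PiK : Pi *m K = K by rewrite KB PiE !mulmxA BBpB.
(* [K - G G^*] is positive and [1 - Pi] projects onto the kernel of [K], so
   [1 - Pi] must annihilate [G]. *)
have PiG : Pi *m G = G.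
  pose N : 'M[C]_n := 1%:M - Pi.
  have NK : N *m K = 0 by rewrite mulmxBl mul1mx PiK subrr.
  apply/eqP; rewrite eq_sym -subr_eq0 -{1}(mul1mx G) -mulmxBl -/N; apply/eqP.
  apply/matrixP => i j; rewrite ord1 [RHS]mxE; apply/eqP.
  have := psdK (row i N); rewrite -/G mulmxBr mulmxBl -row_mul NK row0 mul0mx sub0r.
  rewrite !mulmxA -(mulmxA (row i N *m G)) -adjmxM -row_mul mxE.
  rewrite mxE big_ord1; move: (N *m G) => y; rewrite !mxE !ord1 oppr_ge0 => le0.
  by rewrite -mul_conjC_eq0 eq_le le0 mul_conjC_ge0.
pose A := Bp *m (D *m K - one *m G^t*) *m Bp.
have [xi xiE] : exists xi, xi = Bp *m G by eexists.
have hA : A^t* = A.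
  rewrite /A !adjmxM adjmxB !adjmxM hermK hBp trmxCK mulmxA.
  by rewrite displacement.
have BA : B *m A = D *m B - one *m xi^t*.
  rewrite /A displacement !mulmxA -PiE mulmxBr !mulmxA PiK PiG -displacement.
  rewrite mulmxBl xiE adjmxM hBp !mulmxA; congr (_ - _).
  by rewrite -mulmxA KB -(mulmxA B) -BpB mulmxA BBpB.
have Bxi : B *m xi = G by rewrite xiE mulmxA -PiE.
have [Q [a [QQ QQ' AQ ra]]] := hermitian_spectral hA.
have [V VQ] : exists V, V = B *m Q^t* by eexists.
have [eta etaE] : exists eta, eta = Q *m xi by eexists.
have Veta : V *m eta = G by rewrite VQ etaE mulmxA -(mulmxA B) QQ' mulmx1.
have VE : V *m diag_mx a = D *m V - one *m eta^t*.
  rewrite VQ etaE adjmxM !mulmxA -mulmxBl -BA AQ !mulmxA.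
  by rewrite -(mulmxA _ Q) QQ mulmx1.
have za i k : z i - a 0 k != 0.
  apply: contra (z_nonreal i i); rewrite subr_eq0 => /eqP ->.
  by rewrite (CrealP (ra k)) subrr.
have Vik i k : V i k = (eta k 0)^* / (z i - a 0 k).
  apply: (mulIf (za i k)); rewrite divfK//.
  have /matrixP/(_ i k) := VE.
  rewrite mul_mx_diag /D mul_diag_mx !mxE big_ord1 !mxE.
  by rewrite mul1r mulrBr [V i k * z i]mulrC => ->; rewrite opprB addrCA subrr addr0.
exists (fun k => a 0 k), (fun k => eta k 0 * (eta k 0)^*); split => //.
- by move=> k; exact: mul_conjC_ge0.
(* The form of [K - G G^*] at [G^* Bp Bp] is [m - m ^+ 2]. *)
- pose m : C := (eta^t* *m eta) 0 0.
  have -> : \sum_k eta k 0 * (eta k 0)^* = m.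
    by rewrite /m mxE; apply: eq_bigr => k _; rewrite !mxE mulrC.
  have m0 : 0 <= m.
    by rewrite /m mxE sumr_ge0// => k _; rewrite !mxE mulrC mul_conjC_ge0.
  have mE : eta^t* *m eta = G^t* *m Bp *m Bp *m G.
    by rewrite etaE adjmxM !mulmxA -(mulmxA _ (Q^t*) Q) QQ' mulmx1 xiE adjmxM hBp !mulmxA.
  have := psdK (G^t* *m Bp *m Bp); rewrite -/G !adjmxM hBp trmxCK.
  have -> : G^t* *m Bp *m Bp *m (K - G *m G^t*) *m (Bp *m (Bp *m G)) =
      (eta^t* *m eta) - (eta^t* *m eta) *m (eta^t* *m eta).
    rewrite mulmxBr mulmxBl mE !mulmxA; congr (_ - _).
    by rewrite -!mulmxA; congr (_ *m _); rewrite !mulmxA BpK.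
  rewrite mxE [X in _ + X]mxE [X in _ - X]mxE big_ord1 -/m -{1}(mulr1 m) -mulrBr.
  have [->|m1] := eqVneq m 0; first by rewrite ler01.
  by rewrite pmulr_rge0 ?subr_ge0// lt_def m1.
- move=> i; have /matrixP/(_ i 0) := Veta; rewrite !mxE => <-.
  by apply: eq_bigr => k _; rewrite Vik; ring.
Qed.

End finite_interpolation.


(** * The Cauchy kernel on the compactified line *)

Section compactified_kernel.
Context {R : realType}.
Local Notation C := R[i].
Local Notation upper := (@upper_half_plane R).
Local Notation Re := complex.Re.
Local Notation Im := complex.Im.
Implicit Types (z : C) (x t : R).

(** The function [1 / (z - t)] in the coordinate [x = t / (1 + |t|)] of the
    interval [-1, 1]; both end points stand for the point at infinity, where it
    vanishes. The formula is continuous and bounded on the whole line. *)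
Definition ckernel z x : C := (1 - `|x|)%:C / (z * (1 - `|x|)%:C - x%:C).

Lemma ckernel_den_gt0 z x : upper z -> 0 < nsq (z * (1 - `|x|)%:C - x%:C).
Proof.
move=> z0; have y0 : 0 < Im z by []; rewrite nsq_gt0; apply/eqP => e0.
have := congr1 (@complex.Im R) e0; have := congr1 (@complex.Re R) e0.
rewrite !ReImE/= !mulr0 !subr0 add0r => re0 /eqP.
rewrite mulf_eq0 gt_eqF//= => /eqP x1.
move: re0; rewrite x1 mulr0 sub0r => /eqP; rewrite oppr_eq0 => /eqP x0.
by move: x1; rewrite x0 normr0 subr0 => /eqP; rewrite oner_eq0.
Qed.

Lemma Re_ckernel z x : Re (ckernel z x) =
  (1 - `|x|) * (Re z * (1 - `|x|) - x) * (nsq (z * (1 - `|x|)%:C - x%:C))^-1.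
Proof. by rewrite /ckernel cReM cReV !ReImE/=; ring. Qed.

Lemma Im_ckernel z x : Im (ckernel z x) =
  - (Im z * (1 - `|x|) ^+ 2 * (nsq (z * (1 - `|x|)%:C - x%:C))^-1).
Proof. by rewrite /ckernel cImM cImV cReV !ReImE/=; ring. Qed.

Lemma nsq_ckernel_le z x : upper z -> nsq (ckernel z x) <= (Im z ^+ 2)^-1.
Proof.
move=> z0; have y0 : 0 < Im z by [].
have d0 := ckernel_den_gt0 x z0.
rewrite /ckernel nsqM nsqV ler_pdivrMr// mulrC ler_pdivlMr ?exprn_gt0//.
rewrite /nsq !ReImE/= expr0n/= !mulr0 add0r !addr0 subr0 oppr0 addr0.
rewrite -exprMn [X in X ^+ 2 <= _]mulrC.
by rewrite lerDr sqr_ge0.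
Qed.

Lemma ckernel_den_cvg z x : upper z ->
  (nsq (z * (1 - `|t|)%:C - t%:C))^-1 @[t --> x] -->
  (nsq (z * (1 - `|x|)%:C - x%:C))^-1.
Proof.
move=> z0; apply: cvgV; first by rewrite gt_eqF// ckernel_den_gt0.
have c1 : (1 - `|t|) @[t --> x] --> 1 - `|x|.
  by apply: cvgB; [exact: cvg_cst|apply: cvg_norm; exact: cvg_id].
have e t : nsq (z * (1 - `|t|)%:C - t%:C) =
    (Re z * (1 - `|t|) - t) * (Re z * (1 - `|t|) - t) +
    (Im z * (1 - `|t|)) * (Im z * (1 - `|t|)).
  by rewrite /nsq !ReImE/=; ring.
have c2 : (Re z * (1 - `|t|) - t) @[t --> x] --> Re z * (1 - `|x|) - x.
  by apply: cvgB; [apply: cvgM => //; exact: cvg_cst|exact: cvg_id].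
have c3 : (Im z * (1 - `|t|)) @[t --> x] --> Im z * (1 - `|x|).
  by apply: cvgM => //; exact: cvg_cst.
rewrite e; under eq_fun do rewrite e.
exact: cvgD (cvgM c2 c2) (cvgM c3 c3).
Qed.

Lemma Re_ckernel_cvg z x : upper z -> Re (ckernel z t) @[t --> x] --> Re (ckernel z x).
Proof.
move=> z0; have c1 : (1 - `|t|) @[t --> x] --> 1 - `|x|.
  by apply: cvgB; [exact: cvg_cst|apply: cvg_norm; exact: cvg_id].
rewrite Re_ckernel; under eq_fun do rewrite Re_ckernel.
apply: cvgM; last exact: ckernel_den_cvg.
by apply: cvgM => //; apply: cvgB; [apply: cvgM => //; exact: cvg_cst|exact: cvg_id].
Qed.

Lemma Im_ckernel_cvg z x : upper z -> Im (ckernel z t) @[t --> x] --> Im (ckernel z x).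
Proof.
move=> z0; have c1 : (1 - `|t|) @[t --> x] --> 1 - `|x|.
  by apply: cvgB; [exact: cvg_cst|apply: cvg_norm; exact: cvg_id].
rewrite Im_ckernel; under eq_fun do rewrite Im_ckernel expr2.
apply: cvgN; rewrite expr2; apply: cvgM; last exact: ckernel_den_cvg.
by apply: cvgM; [exact: cvg_cst|exact: cvgM].
Qed.

Lemma ckernel1 z : ckernel z 1 = 0.
Proof. by rewrite /ckernel normr1 subrr mul0r. Qed.

Lemma ckernelE z x : upper z -> `|x| < 1 ->
  ckernel z x = (z - (x / (1 - `|x|))%:C)^-1.
Proof.
move=> z0 x1; have y0 : 1 - `|x| != 0 by rewrite subr_eq0 gt_eqF.
have y1 : (1 - `|x|)%:C != 0 :> C by rewrite eq_complex /= eqxx andbT.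
rewrite /ckernel (_ : z * _ - _ = (1 - `|x|)%:C * (z - (x / (1 - `|x|))%:C)).
  by rewrite invfM mulVKf.
by apply: complexP; rewrite !ReImE/=; field.
Qed.

Definition squash t : R := t / (1 + `|t|).

Lemma squash_lt1 t : `|squash t| < 1.
Proof.
have t1 : 0 < 1 + `|t| by rewrite ltr_pwDl.
by rewrite /squash normrM normfV (gtr0_norm t1) ltr_pdivrMr// mul1r ltrDr.
Qed.

Lemma ckernel_squash z t : upper z -> ckernel z (squash t) = (z - t%:C)^-1.
Proof.
move=> z0; rewrite ckernelE ?squash_lt1//.
have t1 : 0 < 1 + `|t| by rewrite ltr_pwDl.
rewrite /squash normrM normfV (gtr0_norm t1).
have -> : 1 - `|t| / (1 + `|t|) = (1 + `|t|)^-1 by field; rewrite gt_eqF.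
by rewrite invrK divfK// gt_eqF.
Qed.

Lemma cbounded_ckernel d (T : measurableType d) z (th : T -> R) : upper z ->
  measurable_fun setT th -> cbounded (fun s => ckernel z (th s)).
Proof.
move=> z0 mth; split; last by exists (Im z ^+ 2)^-1 => s; exact: nsq_ckernel_le.
- apply: (@measurableT_comp _ _ _ _ _ _ (fun x => Re (ckernel z x)) _ th) => //.
  by apply: continuous_measurable_fun => x; exact: Re_ckernel_cvg.
- apply: (@measurableT_comp _ _ _ _ _ _ (fun x => Im (ckernel z x)) _ th) => //.
  by apply: continuous_measurable_fun => x; exact: Im_ckernel_cvg.
Qed.

End compactified_kernel.

(** * Quantile functions of discrete measures *)

Section quantile_step.
Context {R : realType}.
Local Notation P := (uniform_prob (@ltr01 R)).
Implicit Types (l : seq (R * R)) (f : R -> R).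

(** For a list of pairs (position, mass) with increasing positions this is, from
    abscissa [a] on, the quantile function of the discrete measure, the missing
    mass being placed at 1. *)
Fixpoint qstep (a : R) l (s : R) : R :=
  if l is (x, p) :: l' then if s < a + p then x else qstep (a + p) l' s else 1.

Lemma measurable_qstep a l : measurable_fun setT (qstep a l).
Proof.
elim: l a => [|[x p] l IHl] a; first exact: measurable_cst.
by apply: measurable_fun_ifT => //; exact: measurable_fun_ltr.
Qed.

Lemma qstep_ge y a l s : y <= 1 -> all (fun xp => y <= xp.1) l -> y <= qstep a l s.
Proof.
move=> y1; elim: l a => [//|[x p] l IHl] a /= /andP[yx yl].
by case: ifP => // _; exact: IHl.
Qed.

Lemma qstep_le1 a l s : all (fun xp => xp.1 <= 1) l -> qstep a l s <= 1.
Proof.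
elim: l a => [//|[x p] l IHl] a /= /andP[yx yl].
by case: ifP => // _; exact: IHl.
Qed.

Lemma qstep_nondecreasing a l : all (fun xp => xp.1 <= 1) l ->
  sorted (fun xp yq => xp.1 <= yq.1) l -> {homo qstep a l : s t / s <= t}.
Proof.
move=> + + s t st; elim: l a => [//|[x p] l IHl] a /= /andP[x1 l1] xl.
case: ifPn => sa.
  case: ifPn => // _; apply: qstep_ge => //.
  by apply: (order_path_min _ xl) => ? ? ?; exact: le_trans.
rewrite ifF; last by apply/negbTE; rewrite -leNgt (le_trans _ st)// leNgt.
by apply: IHl => //; exact: path_sorted xl.
Qed.

Lemma uniform_prob_itv (a b : R) : 0 <= a -> a <= b -> b <= 1 ->
  P `[a, b[%classic = (b - a)%:E.
Proof.
move=> a0 ab b1; rewrite /uniform_prob.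
rewrite (eq_integral (fun=> 1%E)).
  rewrite integral_cst//= mul1e lebesgue_measure_itv/= lte_fin.
  by have [_|] := ltP a b => //; move=> ba; rewrite (le_anti (introT andP (conj ab ba))) subrr.
move=> x; rewrite inE/= in_itv/= => /andP[ax xb]; rewrite /uniform_pdf.
by rewrite (le_trans a0 ax) (le_trans (ltW xb) b1) subr0 invr1.
Qed.

Lemma uniform_prob_neg : P `]-oo, 0[%classic = 0%E.
Proof.
rewrite /uniform_prob integral_uniform_pdf (_ : _ `&` _ = set0) ?integral_set0//.
rewrite -subset0 => x [] /=; rewrite !in_itv/= => x0 /andP[x1 _].
by move: (lt_le_trans x0 x1); rewrite ltxx.
Qed.

Lemma Rintegral_qstep_itv f (M : R) a l : measurable_fun setT f ->
  (forall x, f x ^+ 2 <= M) -> f 1 = 0 ->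
  all (fun xp => 0 <= xp.2) l -> 0 <= a -> a + \sum_(xp <- l) xp.2 <= 1 ->
  \int[P]_(s in `[a, +oo[) f (qstep a l s) = \sum_(xp <- l) xp.2 * f xp.1.
Proof.
move=> mf fM f1; elim: l a => [|[x p] l IHl] a /=.
  by move=> _ _ _; rewrite big_nil f1 Rintegral_cst// mul0r.
move=> /andP[p0 pl] a0; rewrite !big_cons/= addrA => ap1.
have S0 : 0 <= \sum_(xp <- l) xp.2.
  by rewrite big_seq sumr_ge0// => xp /(allP pl).
have split_itv : `[a, +oo[%classic = `[a, a + p[%classic `|` `[a + p, +oo[%classic.
  by rewrite -itv_bndbnd_setU//= ?bnd_simp ?lerDl.
have mq : measurable_fun setT (qstep a ((x, p) :: l)) by exact: measurable_qstep.
rewrite split_itv Rintegral_setU//; last 2 first.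
- rewrite -split_itv; apply: (integrableS measurableT) => //.
  apply: (bounded_integrable P (M := M)) => [|s]; last exact: fM.
  exact: (measurableT_comp mf mq).
- apply/disj_setPS => y [] /=; rewrite !in_itv/= andbT => /andP[_ y1] y2.
  by move: (lt_le_trans y1 y2); rewrite ltxx.
congr (_ + _).
- transitivity (\int[P]_(s in `[a, a + p[) f x).
    by apply: eq_Rintegral => s; rewrite inE/= in_itv/= => /andP[_ ->].
  rewrite Rintegral_cst//= [X in fine X]uniform_prob_itv ?lerDl//.
    by rewrite /= addrAC subrr add0r mulrC.
  by apply: le_trans ap1; rewrite lerDl.
- rewrite -(IHl (a + p)) ?addr_ge0//; apply: eq_Rintegral => s.
  by rewrite inE/= in_itv/= andbT leNgt => /negbTE ->.
Qed.

(** The hypothesis [f 1 = 0] cancels the contribution of the missing mass. *)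
Lemma Rintegral_qstep f (M : R) l : measurable_fun setT f ->
  (forall x, f x ^+ 2 <= M) -> f 1 = 0 ->
  all (fun xp => 0 <= xp.2) l -> \sum_(xp <- l) xp.2 <= 1 ->
  \int[P]_s f (qstep 0 l s) = \sum_(xp <- l) xp.2 * f xp.1.
Proof.
move=> mf fM f1 pl p1.
rewrite -(Rintegral_qstep_itv (a := 0) mf fM f1 pl (lexx _)) ?add0r//.
have mfq : measurable_fun setT (fun s => f (qstep 0 l s)).
  by apply: measurableT_comp => //; exact: measurable_qstep.
have split_T : [set: R] = `]-oo, 0[%classic `|` `[0, +oo[%classic.
  by rewrite -itv_bndbnd_setU//= set_itvNyy.
rewrite split_T Rintegral_setU//.
- rewrite [X in X + _](_ : _ = 0) ?add0r//.
  rewrite /Rintegral null_set_integral//; last exact: uniform_prob_neg.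
  by apply: measurable_funTS; exact/measurable_EFinP.
- by rewrite -split_T; apply: bounded_integrable.
- apply/disj_setPS => y [] /=; rewrite !in_itv/= andbT => y1 y2.
  by move: (lt_le_trans y1 y2); rewrite ltxx.
Qed.

End quantile_step.


(** * Helly selection for bounded monotone functions *)

Section helly.
Context {R : realType}.

(** A cluster point of all the sequences at once is provided by a free ultrafilter
    [U] on [nat]: at step [k] an index is taken from the set, which belongs to [U],
    where the first [k] sequences are close to their limits along [U]. The indices
    [sg k] need not increase; going to infinity suffices for the use made of
    them. *)
Lemma bounded_diagonal (x : nat -> nat -> R) : (forall j n, `|x j n| <= 1) ->
  exists (phi : nat -> R) (sg : nat -> nat), [/\ forall j, `|phi j| <= 1,
    forall k, (k <= sg k)%N & forall j, x j (sg k) @[k --> \oo] --> phi j].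
Proof.
move=> x1.
have [U [ultraU nU]] := ultraFilterLemma (eventually_filter : ProperFilter \oo).
have pU : ProperFilter U by exact: ultra_proper.
have /choice[phi phiP] : forall j, exists l, `|l| <= 1 /\ x j n @[n --> U] --> l.
  move=> j; have [|l [l1 cl]] := @segment_compact R (-1) 1 (x j n @[n --> U]) _.
    by apply: nU; exists 0%N => // n _ /=; rewrite in_itv/= -ler_norml; exact: x1.
  exists l; split; first by move: l1; rewrite /= in_itv/= -ler_norml.
  move=> B lB; have [//|UnB] := in_ultra_setVsetC (x j @^-1` B) ultraU.
  by have [y [nBy By]] := cl (~` B) B UnB lB.
have /choice[sg sgP] : forall k, exists n, (k <= n)%N /\
    forall j, (j <= k)%N -> `|phi j - x j n| <= k.+1%:R^-1.
  move=> k.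
  have near_j m : \forall n \near U, forall j, (j <= m)%N ->
      `|phi j - x j n| <= k.+1%:R^-1.
    have k0 : (0 : R) < k.+1%:R^-1 by rewrite invr_gt0.
    elim: m => [|m IHm]; near=> n => j.
      rewrite leqn0 => /eqP ->; near: n.
      exact: (cvgr_dist_le _ _ (phiP 0%N).2 _ k0).
    rewrite leq_eqVlt => /predU1P[->|jm].
      by near: n; exact: (cvgr_dist_le _ _ (phiP m.+1).2 _ k0).
    have IHn : forall j, (j <= m)%N -> `|phi j - x j n| <= k.+1%:R^-1 by near: n.
    exact: IHn.
  have near_k : \forall n \near U, (k <= n)%N by apply: nU; exact: nbhs_infty_ge.
  by have [n [n1 n2]] := filter_ex (filterI near_k (near_j k)); exists n.
exists phi, sg; split.
- by move=> j; have [] := phiP j.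
- by move=> k; have [] := sgP k.
- move=> j; apply/cvgrPdist_le => /= e e0.
  have h : (k.+1%:R^-1 : R) @[k --> \oo] --> 0 := cvg_harmonic.
  near=> k.
  have [_ /(_ j)] := sgP k.
  have jk : (j <= k)%N by near: k; exact: nbhs_infty_ge.
  move=> /(_ jk)/le_trans; apply; apply: (le_trans (ler_norm _)).
  by near: k; exact: (cvgr0_norm_le _ h _ e0).
Unshelve. all: by end_near. Qed.

Local Notation P := (uniform_prob (@ltr01 R)).

(** A monotone function has countably many jumps, and countable sets are null.
    Left continuity suffices for Helly's theorem below, where the selected limit
    is right continuous by construction. *)
Lemma nondecreasing_ae_continuous (F : R -> R) : {homo F : s t / s <= t} ->
  {ae P, forall s, forall e, 0 < e -> exists2 t, t < s & F s - e < F t}.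
Proof.
move=> ndF.
pose D := [set x | x \in `]-1, 2[%R /\ discontinuity F x].
have cD : countable D by apply: discontinuity_countable => s t _ _; exact: ndF.
have mD : measurable D by exact: countable_measurable.
have PC0 : P (~` `]-1, 2[%classic) = 0%E.
  rewrite /uniform_prob integral_uniform_pdf (_ : _ `&` _ = set0) ?integral_set0//.
  rewrite -subset0 => x [] /= + /=; rewrite !in_itv/= => + /andP[x0 x1]; apply.
  by apply/andP; split; lra.
have D0 : P (D `|` ~` `]-1, 2[%classic) = 0%E.
  apply: null_set_setU => //; first exact: measurableC.
  apply: (null_content_dominatesP _ _).1 (dominates_uniform_prob _) _ mD _.
  exact: countable_lebesgue_measure0.
exists (D `|` ~` `]-1, 2[%classic); split => //.
  by apply: measurableU => //; exact: measurableC.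
move=> s /=; apply: contra_notP => /not_orP[nD /contrapT s12] e e0.
have cl : cvg (F x @[x --> s^'-]).
  apply: nondecreasing_at_left_is_cvgr; near=> x; first by move=> ? ? _ _; exact: ndF.
  by exists (F s) => _ [y /= /[!in_itv]/= /andP[_ ys] <-]; exact/ndF/ltW.
have cr : cvg (F x @[x --> s^'+]).
  apply: nondecreasing_at_right_is_cvgr; near=> x; first by move=> ? ? _ _; exact: ndF.
  by exists (F s) => _ [y /= /[!in_itv]/= /andP[sy _] <-]; exact/ndF/ltW.
have lr : lim (F x @[x --> s^'-]) = lim (F x @[x --> s^'+]).
  by apply/eqP/negP => /negP ne; apply: nD.
have Fs : F s <= lim (F x @[x --> s^'-]).
  rewrite lr; apply: limr_ge => //; near=> t; apply: ndF; apply: ltW.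
  by near: t; exact: nbhs_right_gt.
have sL : F s - e < lim (F x @[x --> s^'-]) by rewrite (lt_le_trans _ Fs)// ltrBlDr ltrDl.
have [t [ts Ft]] := filter_ex (filterI (nbhs_left_lt s) (cvgr_gt _ cl _ sL)).
by exists t.
Unshelve. all: by end_near. Qed.

(** The limits [psi] at rational points are monotone, and [F] is their infimum
    from the right. At [s], the values of the selected functions are squeezed
    between those at rationals on both sides of [s], which have limits close to
    [F s] as soon as [F] has no jump there. *)
Theorem helly_selection (th : nat -> R -> R) :
  (forall n, {homo th n : s t / s <= t}) -> (forall n s, `|th n s| <= 1) ->
  exists (F : R -> R) (sg : nat -> nat), [/\ {homo F : s t / s <= t},
    forall s, `|F s| <= 1, forall k, (k <= sg k)%N &
    {ae P, forall s, th (sg k) s @[k --> \oo] --> F s}].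
Proof.
move=> nd b1.
pose rt (j : nat) : rat := odflt 0 (unpickle j).
have rtK q : rt (pickle q) = q by rewrite /rt pickleK.
have [phi [sg [phi1 sgk phic]]] := bounded_diagonal
  (fun j n => b1 n (ratr (rt j))).
pose psi (q : rat) := phi (pickle q).
have psic q : th (sg k) (ratr q) @[k --> \oo] --> psi q.
  by have := phic (pickle q); rewrite rtK.
pose A (s : R) := [set psi q | q in [set q : rat | s < ratr q]].
have A0 s : A s !=set0.
  have s1 : s < s + 1 by rewrite ltrDl.
  have [q] := rat_in_itvoo s1.
  by rewrite in_itv/= => /andP[sq _]; exists (psi q), q.
have Alb s : lbound (A s) (-1).
  by move=> _ [q _ <-]; have := phi1 (pickle q); rewrite ler_norml => /andP[].
have hA s : has_inf (A s) by split => //; exists (-1).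
pose F (s : R) := inf (A s).
have ndF : {homo F : s t / s <= t}.
  move=> s t st; apply: lb_le_inf => // _ [q /= tq <-].
  apply: ge_inf; first by exists (-1).
  by exists q => //=; exact: le_lt_trans tq.
exists F, sg; split => //.
  move=> s; rewrite ler_norml lb_le_inf//=.
  have [_ [q sq _]] := A0 s; apply: (@le_trans _ _ (psi q)).
    by apply: ge_inf; [exists (-1)|exists q].
  exact: le_trans (ler_norm _) (phi1 _).
have [N [mN N0 subN]] := nondecreasing_ae_continuous ndF.
exists N; split => // s /= ncv; apply: subN => /= Fs; apply: ncv.
apply/cvgrPdist_le => /= e e0.
have e2 : 0 < e / 2 by rewrite divr_gt0.
have [t ts Ft] := Fs _ e2.
have [q] := rat_in_itvoo ts; rewrite in_itv/= => /andP[tq qs].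
have [x [q' /= sq' <-{x}] Fq'] := inf_adherent e2 (hA s).
have psiq : F s - e / 2 < psi q.
  apply: (lt_le_trans Ft); apply: ge_inf; first by exists (-1).
  by exists q.
near=> k.
have k1 : `|psi q - th (sg k) (ratr q)| <= e / 2.
  by near: k; exact: (cvgr_dist_le _ _ (psic q) _ e2).
have k2 : `|psi q' - th (sg k) (ratr q')| <= e / 2.
  by near: k; exact: (cvgr_dist_le _ _ (psic q') _ e2).
have m1 := nd (sg k) _ _ (ltW qs).
have m2 := nd (sg k) _ _ (ltW sq').
move: k1 k2 Fq'; rewrite !ler_norml -/(F s) => /andP[? ?] /andP[? ?] ?.
by apply/andP; split; lra.
Unshelve. all: by end_near. Qed.

End helly.


(** * Measures from positive Pick kernels *)

Section unsquash.
Context {R : realType}.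

Definition unsquash (x : R) : R := x / (1 - `|x|).

(** With the convention [0^-1 = 0] the regularised quotients below converge
    everywhere, the end points included. *)
Lemma measurable_unsquash : measurable_fun setT unsquash.
Proof.
apply: (@measurable_fun_cvg _ (measurableTypeR R) R setT (fun k (x : R) =>
  x * (1 - `|x|) / ((1 - `|x|) * (1 - `|x|) + k.+1%:R^-1))) => [k|x _].
- apply: continuous_measurable_fun => x.
  have c1 : (1 - `|t|) @[t --> x] --> 1 - `|x|.
    by apply: cvgB; [exact: cvg_cst|apply: cvg_norm; exact: cvg_id].
  apply: cvgM; first by apply: cvgM => //; exact: cvg_id.
  apply: cvgV; last by apply: cvgD; [exact: cvgM|exact: cvg_cst].
  by rewrite gt_eqF// ltr_wpDl// -expr2 sqr_ge0.
- have [x1|x1] := eqVneq (1 - `|x|) 0.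
    rewrite /unsquash x1 invr0 mulr0.
    by under eq_fun do rewrite mul0r; exact: cvg_cst.
  rewrite [X in _ --> X](_ : _ = x * (1 - `|x|) / ((1 - `|x|) * (1 - `|x|) + 0));
    last by rewrite /unsquash addr0; field.
  apply: cvgM; first exact: cvg_cst.
  apply: cvgV; first by rewrite addr0 mulf_neq0.
  by apply: cvgD; [exact: cvg_cst|exact: cvg_harmonic].
Qed.

End unsquash.

Section pick_excess.
Context {R : realType}.
Local Notation C := R[i].
Local Notation upper := (@upper_half_plane R).
Local Notation Re := complex.Re.
Local Notation Im := complex.Im.
Local Notation P := (uniform_prob (@ltr01 R)).

Variable Z : C -> C.
(* Equivalently, the Pick kernel of [Z] dominates the constant kernel 1, see
   [pick_excessE]. *)
Hypothesis pZ : pick_positive (fun z => Z z - z).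

Lemma Im_excess z : upper z -> Im z <= Im (Z z).
Proof. by move=> z0; have := pick_Im_ge0 pZ z0; rewrite cImD cImN subr_ge0. Qed.

Lemma upper_excess z : upper z -> upper (Z z).
Proof. by move=> z0; apply: lt_le_trans (Im_excess z0). Qed.

Lemma pick_excessE z w : upper z -> upper w ->
  pick (fun z => Z z - z) z w = pick Z z w - 1.
Proof.
move=> z0 w0; rewrite /pick; have := upper_sub_conj z0 w0 => zw.
by rewrite conjcB; field.
Qed.

Lemma pick_positive_excess : pick_positive Z.
Proof.
move=> n w uw; apply: psd_ext (psdD (pZ uw) (@psd1 _ n)) => i j.
by rewrite pick_excessE// subrK.
Qed.

(** The reciprocal is again subject to Schwarz-Pick, and its imaginary part is
    bounded by [1 / Im z] since [Im z <= Im (Z z)]. *)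
Lemma nsq_invB_le z w : upper z -> upper w ->
  nsq ((Z z)^-1 - (Z w)^-1) * (Im z * Im w) ^+ 2 <= nsq (z - w).
Proof.
move=> z0 w0; have [Z0 W0] := (upper_excess z0, upper_excess w0).
have SP := schwarz_pick pick_positive_excess z0 w0.
have [y0 x0] : 0 < Im z /\ 0 < Im w by [].
have -> : (Z z)^-1 - (Z w)^-1 = - (Z z - Z w) / (Z z * Z w).
  by field; rewrite !upper_neq0.
rewrite nsqM nsqV nsqN nsqM.
have nz : 0 < nsq (Z z) * nsq (Z w) by rewrite mulr_gt0// upper_nsq.
rewrite mulrAC ler_pdivrMr//.
have YZ : Im z * Im (Z z) <= nsq (Z z).
  have := Im_excess z0; have := sqr_ge0 (Re (Z z)); rewrite /nsq; nra.
have YW : Im w * Im (Z w) <= nsq (Z w).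
  have := Im_excess w0; have := sqr_ge0 (Re (Z w)); rewrite /nsq; nra.
apply: (@le_trans _ _ (nsq (z - w) * (Im (Z z) * Im (Z w)) * (Im z * Im w))).
  rewrite [X in X <= _](_ : _ = nsq (Z z - Z w) * (Im z * Im w) * (Im z * Im w)); last by ring.
  exact: (ler_wpM2r (mulr_ge0 (ltW y0) (ltW x0)) SP).
rewrite -mulrA ler_wpM2l ?nsq_ge0//.
rewrite (_ : _ * _ * _ = (Im z * Im (Z z)) * (Im w * Im (Z w))); last by ring.
have [a b] : 0 < Im (Z z) /\ 0 < Im (Z w) by [].
by apply: ler_pM => //; rewrite mulr_ge0// ltW.
Qed.

(** Here [g = 1 / Z] satisfies the hypotheses of [finite_interpolation], because
    the Pick matrix of [Z] minus the matrix of ones is congruent, through the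
    diagonal matrix of [g], to [K - G *m G^t*]. *)
Lemma interpolating_quantile n (w : 'I_n -> C) : (forall i, upper (w i)) ->
  exists th : R -> R, [/\ {homo th : s t / s <= t}, forall s, `|th s| <= 1 &
    forall i, cexp P (fun s => ckernel (w i) (th s)) = (Z (w i))^-1].
Proof.
move=> uw; pose g i := (Z (w i))^-1.
have Zn0 i : Z (w i) != 0 by exact/upper_neq0/upper_excess.
have wn0 i j : w i - (w j)^* != 0 by exact: upper_sub_conj.
pose K : 'M[C]_n := \matrix_(i, j) (((g j)^* - g i) / (w i - (w j)^*)).
have KE i j : (w i - (w j)^*) * K i j = (g j)^* - g i.
  by rewrite mxE mulrC divfK.
have pK : psd (fun i j => K i j - g i * (g j)^*).
  apply: psd_ext (psd_cong g (pZ uw)) => i j.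
  rewrite pick_excessE// mxE /pick /g conjcV; field.
  by rewrite !Zn0 wn0 conjc_neq0 Zn0.
have psdK (x : 'rV[C]_n) : 0 <= (x *m (K - (\col_i g i) *m
    (map_mx Num.conj (\col_i g i)^T)) *m (map_mx Num.conj x^T)) 0 0.
  have := pK (fun i => x 0 i); congr (_ <= _).
  rewrite mxE exchange_big; apply: eq_bigr => j _.
  rewrite [X in _ = X * _]mxE mulr_suml; apply: eq_bigr => i _.
  by rewrite !mxE big_ord1 !mxE; ring.
have [a [p [ra p0 p1 gE]]] := finite_interpolation wn0 KE psdK.
have aE k : a k = (Re (a k))%:C by rewrite RRe_real.
have pE k : p k = (Re (p k))%:C by rewrite RRe_real// ger0_real.
pose l := sort (fun u v : R * R => u.1 <= v.1)
  [seq (squash (Re (a k)), Re (p k)) | k <- enum 'I_n].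
have bigl (F : R * R -> R) : \sum_(xp <- l) F xp =
    \sum_k F (squash (Re (a k)), Re (p k)).
  by rewrite (perm_big _ (permEl (perm_sort _ _))) big_map big_enum.
have l1 : all (fun xp : R * R => `|xp.1| <= 1) l.
  rewrite all_sort all_map; apply/allP => k _ /=; exact/ltW/squash_lt1.
have lp : all (fun xp : R * R => 0 <= xp.2) l.
  by rewrite all_sort all_map; apply/allP => k _ /=; have /ge0cP[] := p0 k.
have lsum : \sum_(xp <- l) xp.2 <= 1.
  by rewrite bigl/= -Re_sum; move: p1; rewrite lecE => /andP[_].
have lsorted : sorted (fun u v : R * R => u.1 <= v.1) l.
  by apply: sort_sorted => u v; exact: le_total.
have sumE i (f : C -> R) : (forall x y, f (x + y) = f x + f y) ->
    (forall x : R, forall y, f (x%:C * y) = x * f y) ->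
    \sum_(xp <- l) xp.2 * f (ckernel (w i) xp.1) = f (g i).
  move=> fD fZ; rewrite bigl gE.
  have f0 : f 0 = 0 by have /eqP := fD 0 0; rewrite addr0 -subr_eq subrr => /eqP.
  rewrite (big_morph f fD f0); apply: eq_bigr => k _ /=.
  by rewrite ckernel_squash// [in RHS]pE fZ -aE.
have ReZ (x : R) (y : C) : Re (x%:C * y) = x * Re y.
  by rewrite cReM/= mul0r subr0.
have ImZ (x : R) (y : C) : Im (x%:C * y) = x * Im y.
  by rewrite cImM/= mul0r addr0.
have bk i := @cbounded_ckernel _ _ _ (w i) id (uw i) (@measurable_id _ _ setT).
exists (qstep 0 l); split.
- apply: qstep_nondecreasing => //.
  by apply: sub_all l1 => xp; apply: le_trans; exact: ler_norm.
- move=> s; rewrite ler_norml; apply/andP; split.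
    apply: qstep_ge; first by rewrite (le_trans _ ler01)// oppr_le0.
    by apply: sub_all l1 => xp; rewrite ler_norml => /andP[].
  by apply: qstep_le1; apply: sub_all l1 => xp; apply: le_trans; exact: ler_norm.
- move=> i; have [mr mi _] := bk i; apply: complexP; rewrite /cexp [LHS]/=.
  + rewrite (@Rintegral_qstep _ (fun x => Re (ckernel (w i) x)) (Im (w i) ^+ 2)^-1)//.
    * exact: (sumE i (fun u => Re u) (@cReD R) ReZ).
    * by move=> x; apply: le_trans (nsq_ckernel_le x (uw i)); rewrite lerDl sqr_ge0.
    * by rewrite ckernel1.
  + rewrite (@Rintegral_qstep _ (fun x => Im (ckernel (w i) x)) (Im (w i) ^+ 2)^-1)//.
    * exact: (sumE i (fun u => Im u) (@cImD R) ImZ).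
    * by move=> x; apply: le_trans (nsq_ckernel_le x (uw i)); rewrite lerDr sqr_ge0.
    * by rewrite ckernel1.
Qed.

End pick_excess.


Section nevanlinna_representation.
Context {R : realType}.
Local Notation C := R[i].
Local Notation upper := (@upper_half_plane R).
Local Notation Re := complex.Re.
Local Notation Im := complex.Im.
Local Notation P := (uniform_prob (@ltr01 R) : probability (measurableTypeR R) R).

(** An enumeration of a countable dense subset of the upper half-plane. *)
Definition rat_point (j : nat) : C :=
  let q : rat * rat := odflt (0, 1) (unpickle j) in
  ratr q.1 +i* (if (0 < q.2)%R then ratr q.2 else 1).

Lemma rat_point_upper j : upper (rat_point j).
Proof.
rewrite /upper_half_plane/= /rat_point/=.
by case: ifPn => // q0; rewrite ltr0q.
Qed.

Lemma rat_point_dense z (e : R) : upper z -> 0 < e ->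
  exists2 j, Im z <= Im (rat_point j) & nsq (z - rat_point j) <= e.
Proof.
move=> z0 e0; have y0 : 0 < Im z by [].
pose d := Num.min 1 (e / 2).
have d0 : 0 < d by rewrite lt_min ltr01 divr_gt0.
have zd x : x < x + d by rewrite ltrDl.
have [p] := rat_in_itvoo (zd (Re z)).
rewrite in_itv/= => /andP[p1 p2].
have [q] := rat_in_itvoo (zd (Im z)).
rewrite in_itv/= => /andP[q1 q2].
have q0 : 0 < q by rewrite -(ltr0q R); exact: lt_trans q1.
exists (pickle (p, q)); rewrite /rat_point pickleK/= q0.
  exact: ltW.
have d1 : d <= 1 by rewrite ge_min lexx.
have de : d <= e / 2 by rewrite ge_min lexx orbT.
rewrite /nsq !ReImE/=.
set u := ratr p in p1 p2 *; set v := ratr q in q1 q2 *.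
have a1 : (Re z - u) ^+ 2 <= d by nra.
have a2 : (Im z - v) ^+ 2 <= d by nra.
by lra.
Qed.

(** The measure is the image of the uniform distribution by a quantile function.
    The quantile functions interpolating [1 / Z] at the first [n] points of a dense
    sequence have a limit [F] in the sense of Helly, and bounded convergence
    transports the interpolation to [F] at all points of the sequence. The growth
    hypothesis prevents a loss of mass at infinity, that is at [|F s| = 1]. Finally
    both [1 / Z] and the Cauchy transform so obtained are continuous, so they agree
    off the dense sequence as well. *)
Theorem class_F_of_pick (Z : C -> C) :
  pick_positive (fun z => Z z - z) ->
  (forall e : R, 0 < e -> exists2 n, (0 < n)%N &
     1 - e <= n%:R * (Im (Z (0 +i* n%:R)) / nsq (Z (0 +i* n%:R)))) ->
  class_F Z.
Proof.
move=> pZ gZ.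
have /choice[th thP] : forall n, exists th : R -> R,
    [/\ {homo th : s t / s <= t}, forall s, `|th s| <= 1 &
     forall i : 'I_n.+1,
       cexp P (fun s => ckernel (rat_point i) (th s)) = (Z (rat_point i))^-1].
  by move=> n; apply: interpolating_quantile => // i; exact: rat_point_upper.
have [F [sg [ndF F1 sgk cF]]] := helly_selection
  (fun n => let: And3 h _ _ := thP n in h) (fun n => let: And3 _ h _ := thP n in h).
have mF : measurable_fun [set: measurableTypeR R] F.
  exact: nondecreasing_measurable.
have mth n : measurable_fun [set: measurableTypeR R] (th n).
  by apply: nondecreasing_measurable => //; have [] := thP n.
have limF j : cexp P (fun s => ckernel (rat_point j) (F s)) = (Z (rat_point j))^-1.
  have uj := rat_point_upper j.
  have thE k : (j <= k)%N ->
      cexp P (fun s => ckernel (rat_point j) (th (sg k) s)) = (Z (rat_point j))^-1.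
    move=> jk; have [_ _ H] := thP (sg k).
    have jsg : (j < (sg k).+1)%N by rewrite ltnS (leq_trans jk).
    exact: (H (Ordinal jsg)).
  have M0 : (0 : R) <= (Im (rat_point j))^-1 by rewrite invr_ge0 ltW.
  have bd x : nsq (ckernel (rat_point j) x) <= (Im (rat_point j))^-1 ^+ 2.
    by rewrite exprVn; exact: nsq_ckernel_le.
  have [mr mi _] := cbounded_ckernel uj mF.
  apply: complexP.
  - have cv : \int[P]_s Re (ckernel (rat_point j) (th (sg k) s)) @[k --> \oo] -->
        \int[P]_s Re (ckernel (rat_point j) (F s)).
      apply: (@Rintegral_bounded_cvg _ _ _ P _ _ (Im (rat_point j))^-1) => //.
      + by move=> k; have [] := cbounded_ckernel uj (mth (sg k)).
      + by move=> k s; exact: Re_le_nsq.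
      + have [N [mN N0 subN]] := cF.
        exists N; split => // s ncv; apply: subN => Fs; apply: ncv.
        exact: (continuous_cvg _ (h := fun x => Re (ckernel (rat_point j) x))
          (@Re_ckernel_cvg R _ (F s) uj) Fs).
    have cst : \int[P]_s Re (ckernel (rat_point j) (th (sg k) s)) @[k --> \oo] -->
        Re (Z (rat_point j))^-1.
      apply: cvg_near_cst; near=> k.
      apply: (congr1 (@complex.Re R) (thE k _)).
      by near: k; exact: nbhs_infty_ge.
    exact: (cvg_unique _ cv cst).
  - have cv : \int[P]_s Im (ckernel (rat_point j) (th (sg k) s)) @[k --> \oo] -->
        \int[P]_s Im (ckernel (rat_point j) (F s)).
      apply: (@Rintegral_bounded_cvg _ _ _ P _ _ (Im (rat_point j))^-1) => //.
      + by move=> k; have [] := cbounded_ckernel uj (mth (sg k)).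
      + by move=> k s; exact: Im_le_nsq.
      + have [N [mN N0 subN]] := cF.
        exists N; split => // s ncv; apply: subN => Fs; apply: ncv.
        exact: (continuous_cvg _ (h := fun x => Im (ckernel (rat_point j) x))
          (@Im_ckernel_cvg R _ (F s) uj) Fs).
    have cst : \int[P]_s Im (ckernel (rat_point j) (th (sg k) s)) @[k --> \oo] -->
        Im (Z (rat_point j))^-1.
      apply: cvg_near_cst; near=> k.
      apply: (congr1 (@complex.Im R) (thE k _)).
      by near: k; exact: nbhs_infty_ge.
    exact: (cvg_unique _ cv cst).
pose A := [set s | `|F s| < 1].
have mA : measurable (A : set (measurableTypeR R)).
  have mnF : measurable_fun [set: measurableTypeR R] (fun s => `|F s|).
    exact: measurableT_comp.
  have := measurable_fun_ltr mnF (measurable_cst (1 : R)).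
  by move=> /(_ measurableT [set true] _); rewrite setTI; exact.
have PA : P (~` A) = 0%E.
  (* [- n * Im (ckernel (in))] is at most 1 on [A] and vanishes off [A]. *)
  have PA1 e : 0 < e -> 1 - e <= fine (P A).
    move=> e0; have [n n0 /le_trans] := gZ e e0; apply.
    have n1 : (0 : R) < n%:R by rewrite ltr0n.
    have [j jE] : exists j, 0 +i* n%:R = rat_point j.
      exists (pickle (0 : rat, n%:R : rat)).
      by rewrite /rat_point pickleK/= ltr0n n0 ratr_nat raddf0.
    have uj := rat_point_upper j; rewrite jE.
    have {}jE : Im (rat_point j) = n%:R by rewrite -jE.
    have bF := cbounded_ckernel uj mF.
    have iF := cbounded_Im P bF.
    have -> : Im (Z (rat_point j)) / nsq (Z (rat_point j)) =
        - \int[P]_s Im (ckernel (rat_point j) (F s)).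
      have := congr1 (@complex.Im R) (limF j); rewrite cImV => LF.
      by rewrite -[LHS]opprK -LF.
    rewrite mulrN -mulNr -RintegralZl//.
    have -> : fine (P A) = \int[P]_s (\1_A s).
      by rewrite /Rintegral integral_indic//= setIT.
    apply: le_Rintegral => //; first exact: scaled_integrable.
      apply: (bounded_integrable P (M := 1)) => [|s]; first exact: measurable_indic.
      by rewrite indicE; case: (_ \in _); rewrite ?expr1n// expr0n ler01.
    move=> s _; rewrite indicE; have [sA|sA] := boolP (s \in A).
      rewrite mulNr -mulrN -ler_pdivlMl// mulr1.
      apply: (le_trans (ler_norm _)); rewrite normrN; apply: Im_le_nsq.
        by rewrite invr_ge0 ltW.
      by rewrite -jE exprVn; exact: nsq_ckernel_le.
    have Fs1 : 1 - `|F s| = 0.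
      apply/eqP; rewrite subr_eq0 eq_le F1 andbT leNgt; apply/negP => Fs.
      by move: sA; rewrite notin_setE.
    by rewrite Im_ckernel Fs1 expr0n mulr0 mul0r oppr0 mulr0.
  have PA1' : 1 <= fine (P A).
    by apply/ler_addgt0Pr => e e0; rewrite -lerBlDr; exact: PA1.
  apply/eqP; rewrite eq_le measure_ge0 andbT probability_setC//.
  rewrite -[P A]fineK ?fin_num_measure//.
  by rewrite -EFinB lee_fin subr_le0.
have [nu nuE] : exists nu : probability (measurableTypeR R) R, forall z, upper z ->
    cauchy_transform nu z = cexp P (fun s => ckernel z (F s)).
  have mtau : measurable_fun [set: measurableTypeR R] (fun s => unsquash (F s)).
    apply: (@measurableT_comp _ _ _ _ _ _ (@unsquash R) _ F) => //.
    exact: measurable_unsquash.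
  pose tau_mixin := isMeasurableFun.Build _ _ (measurableTypeR R)
    (measurableTypeR R) (fun s => unsquash (F s)) mtau.
  pose tau : {mfun measurableTypeR R >-> measurableTypeR R} :=
    MeasurableFun.Pack (MeasurableFun.Class tau_mixin).
  exists (distribution P tau) => z z0.
  have bz := cbounded_resolvent z0; have [mr mi [M bd]] := bz.
  transitivity (cexp P (fun s => (z - (tau s)%:C)^-1)); first exact: cexp_distribution.
  apply: eq_cexp_ae.
  - split; [exact: measurableT_comp mr _|exact: measurableT_comp mi _|].
    by exists M => s; exact: bd.
  - exact: cbounded_ckernel.
  - exists (~` A); split => //; first exact: measurableC.
    by move=> s /= H As; apply: H; rewrite ckernelE.
have pnu : pick_positive (fun z => reciprocal_cauchy_transform nu z - z).
  exact: pick_multiplier_positive (pick_multiplier_defect nu).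
exists nu => z z0; apply: invr_inj; rewrite invrK; apply/eqP.
rewrite -subr_eq0 -nsq_eq0 eq_le nsq_ge0 andbT leNgt; apply/negP => neq.
set e := nsq _ in neq.
have y0 : 0 < Im z := z0.
have [|j yj dj] := @rat_point_dense z (e * (Im z ^+ 2) ^+ 2 / 5) z0.
  by rewrite divr_gt0// mulr_gt0// !exprn_gt0.
have uj := rat_point_upper j.
have l1 := nsq_invB_le pZ z0 uj; have l2 := nsq_invB_le pnu z0 uj.
have l3 : e <= 2 * nsq ((Z z)^-1 - (Z (rat_point j))^-1) +
    2 * nsq (cauchy_transform nu z - cauchy_transform nu (rat_point j)).
  rewrite -[X in _ + 2 * X]nsqN; apply: le_trans (nsqD_le _ _).
  by rewrite -limF -nuE// /e le_eqVlt; apply/orP; left; apply/eqP; congr nsq; ring.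
move: l2; rewrite /reciprocal_cauchy_transform !invrK => l2.
have yy : Im z ^+ 2 <= Im z * Im (rat_point j) by rewrite expr2 ler_wpM2l// ltW.
have Y0 : 0 < Im z ^+ 2 by rewrite exprn_gt0.
have D0 : 0 < (Im z * Im (rat_point j)) ^+ 2 by rewrite exprn_gt0// (lt_le_trans Y0).
have D1 : (Im z ^+ 2) ^+ 2 <= (Im z * Im (rat_point j)) ^+ 2.
  by rewrite ler_sqr ?nnegrE// ltW// (lt_le_trans Y0).
have l4 : e * (Im z * Im (rat_point j)) ^+ 2 <= 4 * (e * (Im z ^+ 2) ^+ 2 / 5).
  apply: (le_trans (ler_wpM2r (ltW D0) l3)).
  by rewrite mulrDl -!mulrA; lra.
have := le_trans (ler_wpM2l (ltW neq) D1) l4.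
have : 0 < e * (Im z ^+ 2) ^+ 2 by rewrite mulr_gt0// exprn_gt0.
by move: (e * _) => x x0; lra.
Unshelve. all: by end_near. Qed.

End nevanlinna_representation.


(** * The subordination functions *)

Section subordination.
Context {R : realType}.
Local Notation C := R[i].
Local Notation upper := (@upper_half_plane R).
Local Notation Re := complex.Re.
Local Notation Im := complex.Im.
Implicit Types (z w : C) (a b : nat -> C).

Lemma ccvg_const w : ccvg (fun=> w) w.
Proof. by apply: Re_Im_ccvg; exact: cvg_cst. Qed.

Lemma ccvgD a b z w : ccvg a z -> ccvg b w -> ccvg (fun n => a n + b n) (z + w).
Proof.
move=> az bw; apply: Re_Im_ccvg.
- rewrite cReD; under eq_fun do rewrite cReD.
  by apply: cvgD; exact: ccvg_Re.
- rewrite cImD; under eq_fun do rewrite cImD.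
  by apply: cvgD; exact: ccvg_Im.
Qed.

Lemma ccvgZ c a z : ccvg a z -> ccvg (fun n => c * a n) (c * z).
Proof.
move=> az; have [cr ci] := (ccvg_Re az, ccvg_Im az); apply: Re_Im_ccvg.
- rewrite cReM; under eq_fun do rewrite cReM.
  by apply: cvgB; apply: cvgM => //; exact: cvg_cst.
- rewrite cImM; under eq_fun do rewrite cImM.
  by apply: cvgD; apply: cvgM => //; exact: cvg_cst.
Qed.

Lemma ccvgJ a z : ccvg a z -> ccvg (fun n => (a n)^*) z^*.
Proof.
move=> az; have [cr ci] := (ccvg_Re az, ccvg_Im az); apply: Re_Im_ccvg.
- by rewrite cReJ; under eq_fun do rewrite cReJ.
- by rewrite cImJ; under eq_fun do rewrite cImJ; exact: cvgN.
Qed.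

Lemma ccvg_sum m (a : 'I_m -> nat -> C) (z : 'I_m -> C) :
  (forall i, ccvg (a i) (z i)) -> ccvg (fun n => \sum_i a i n) (\sum_i z i).
Proof.
elim: m a z => [|m IHm] a z az.
  by rewrite big_ord0 /ccvg; under eq_fun do rewrite big_ord0; exact: ccvg_const.
rewrite big_ord_recl /ccvg; under eq_fun do rewrite big_ord_recl.
by apply: ccvgD => //; exact: IHm.
Qed.

Lemma ccvg_ge0 a z : (forall n, 0 <= a n) -> ccvg a z -> 0 <= z.
Proof.
move=> a0 az; have [cr ci] := (ccvg_Re az, ccvg_Im az).
apply/ge0cP; split.
- have i0 : Im (a n) @[n --> \oo] --> (0 : R).
    by apply: cvg_near_cst; apply: nearW => n; have /ge0cP[] := a0 n.
  exact: (cvg_unique _ ci i0).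
- apply: (cvgr_to_ge cr); apply: nearW => n.
  by have /ge0cP[] := a0 n.
Qed.

(** Positivity of the Pick matrices is a closed condition on the values. *)
Lemma pick_positive_limit (A : nat -> C -> C) (Z : C -> C) :
  (forall n, pick_positive (A n)) ->
  (forall z, upper z -> ccvg (A ^~ z) (Z z)) -> pick_positive Z.
Proof.
move=> pA cA m w uw x; apply: (ccvg_ge0 (fun n => pA n m w uw x)).
apply: ccvg_sum => i; apply: ccvg_sum => j; apply: ccvgZ.
have E (f : C -> C) : pick f (w i) (w j) =
    (w i - (w j)^*)^-1 * (f (w i) + (-1) * (f (w j))^*).
  by rewrite /pick mulrC mulN1r.
rewrite E /ccvg; under eq_fun do rewrite E.
apply: ccvgZ; apply: ccvgD; first exact: cA.
by apply: ccvgZ; apply: ccvgJ; exact: cA.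
Qed.

(** The Pick kernel of [z |-> h (A z)] is the product of the Pick kernel of [h] at
    the points [A z] and of the Pick kernel of [A]. *)
Lemma pick_positive_shift (h A : C -> C) : pick_multiplier h ->
  pick_positive (fun z => A z - z) ->
  pick_positive (fun z => (z + h (A z)) - z).
Proof.
move=> mh pA n w uw; have uA i : upper (A (w i)) by exact: upper_excess.
apply: psd_ext (mh n _ uA _ (pick_positive_excess pA uw)) => i j.
rewrite /pick !(addrC _ (h _)) !addrK.
have := upper_sub_conj (uA i) (uA j); have := upper_sub_conj (uw i) (uw j) => ? ?.
by field; apply/andP.
Qed.

(** With [X = r * Im w / |w|^2], membership in the disk gives
    [(1 - X) ^+ 2 <= e ^+ 2], using [X ^+ 2 <= r ^+ 2 / |w|^2] and [X <= 1]. *)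
Lemma disk_ratio (r M e : R) w : 0 < r -> 0 < e -> r <= Im w -> M <= e ^+ 2 * r ->
  disk r M w -> 1 - e <= r * (Im w / nsq w).
Proof.
move=> r0 e0 rw Me; rewrite /disk => D.
have w0 : 0 < Im w := lt_le_trans r0 rw.
have N0 : 0 < nsq w by exact: (@upper_nsq _ w).
have IN : Im w ^+ 2 <= nsq w by rewrite lerDr sqr_ge0.
set X := r * (Im w / nsq w).
have XE : X * nsq w = r * Im w by rewrite /X mulrA divfK// gt_eqF.
have X0 : 0 <= X by rewrite mulr_ge0 ?divr_ge0// ltW.
have X1 : X <= 1.
  rewrite -(ler_pM2r N0) XE mul1r (le_trans _ IN)// expr2.
  by apply: ler_wpM2r => //; exact: ltW.
have D2 : nsq w - 2 * (X * nsq w) + r ^+ 2 <= e ^+ 2 * (X * nsq w).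
  rewrite XE (_ : _ + _ = nsq (w - (0 +i* r))); last by rewrite /nsq !ReImE/=; ring.
  by apply: (le_trans D); rewrite mulrA; apply: ler_wpM2r => //; exact: ltW.
have X2 : X ^+ 2 * nsq w <= r ^+ 2.
  rewrite -(ler_pM2r N0) -mulrA -expr2 -exprMn XE exprMn.
  by apply: ler_wpM2l => //; exact: sqr_ge0.
have : (1 - X) ^+ 2 * nsq w <= e ^+ 2 * nsq w.
  apply: (@le_trans _ _ (e ^+ 2 * (X * nsq w))).
    by apply: le_trans D2; rewrite sqrrB expr1n; lra.
  apply: ler_wpM2l; first exact: sqr_ge0.
  by rewrite ler_piMl// ltW.
rewrite ler_pM2r// ler_pXn2r ?nnegrE ?subr_ge0// ?(ltW e0)// => H.
by lra.
Qed.

Section existence.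
Variables mu1 mu2 : probability (measurableTypeR R) R.
Local Notation h1 := (defect mu1).
Local Notation h2 := (defect mu2).

Let m1 : pick_multiplier h1 := pick_multiplier_defect mu1.
Let m2 : pick_multiplier h2 := pick_multiplier_defect mu2.
Let p1 := pick_multiplier_positive m1.
Let p2 := pick_multiplier_positive m2.

Lemma defects_small (e : R) : 0 < e -> exists2 n, (0 < n)%N &
  nsq (h1 (0 +i* n%:R)) <= e ^+ 2 * n%:R ^+ 2 /\
  nsq (h2 (0 +i* n%:R)) <= e ^+ 2 * n%:R ^+ 2.
Proof.
move=> e0; have e20 : 0 < e ^+ 2 by rewrite exprn_gt0.
have d1 := defect_iy_small mu1 e20; have d2 := defect_iy_small mu2 e20.
by have [n [[? ?] ?]] := filter_ex (filterI (filterI d1 d2) (nbhs_infty_gt 0)); exists n.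
Qed.

Lemma Im_defect_le (h : C -> C) (n : nat) (e : R) : 0 < e ->
  nsq (h (0 +i* n%:R)) <= e ^+ 2 * n%:R ^+ 2 -> Im (h (0 +i* n%:R)) <= e * n%:R.
Proof.
move=> e0 H; apply: (le_trans (ler_norm _)); apply: Im_le_nsq.
  by rewrite mulr_ge0// ltW.
by rewrite exprMn.
Qed.

(** Since [h1] and [h2] are [o(z)], the disks centred at [in] satisfy the
    hypotheses of [shift_fixpoint] once [n] and then [M] are large. *)
Lemma subordination_exists z : upper z -> exists w, [/\ upper w,
  w = z + h2 (z + h1 w) &
  ccvg (fun n => iter n (fun w => z + h2 (z + h1 w)) z) w].
Proof.
move=> z0; have y0 : 0 < Im z := z0.
have e8 : (0 : R) < 1 / 8 by rewrite divr_gt0.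
have [n n0 [s1 s2]] := defects_small e8.
have r0 : (0 : R) < n%:R by rewrite ltr0n.
have i1 : Im (h1 (0 +i* n%:R)) <= n%:R / 8.
  by rewrite mulrC -[_^-1]mul1r; apply: Im_defect_le => //; rewrite divr_gt0.
have i2 : Im (h2 (0 +i* n%:R)) <= n%:R / 8.
  by rewrite mulrC -[_^-1]mul1r; apply: Im_defect_le => //; rewrite divr_gt0.
set r : R := n%:R in r0 i1 i2 *.
pose M := (nsq (z - (0 +i* r)) + 8 / 3 * nsq (z + h1 (0 +i* r) - (0 +i* r)) +
  8 / 3 * nsq (z + h2 (0 +i* r) - (0 +i* r))) / Im z.
have [N0 N1 N2] := And3 (nsq_ge0 (z - (0 +i* r)))
  (nsq_ge0 (z + h1 (0 +i* r) - (0 +i* r))) (nsq_ge0 (z + h2 (0 +i* r) - (0 +i* r))).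
have ME : M * Im z = nsq (z - (0 +i* r)) + 8 / 3 * nsq (z + h1 (0 +i* r) - (0 +i* r)) +
  8 / 3 * nsq (z + h2 (0 +i* r) - (0 +i* r)) by rewrite /M divfK// gt_eqF.
have M0 : 0 <= M by rewrite /M divr_ge0//; [lra|exact: ltW].
have [|||w [w0 wE _ cw]] := shift_fixpoint p1 p2 z0 r0 M0 i1 i2.
- by rewrite ME; lra.
- by rewrite ME; lra.
- by rewrite /disk ME; lra.
by exists w; split.
Qed.

Variable Z : C -> C.
Hypothesis ZP : forall z, upper z -> [/\ upper (Z z),
  Z z = z + h2 (z + h1 (Z z)) &
  ccvg (fun n => iter n (fun w => z + h2 (z + h1 w)) z) (Z z)].

(** The starting function [z |-> z] has kernel 0, each iterate inherits positivity
    from the previous one, and the limit from the iterates. *)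
Lemma pick_positive_subordination : pick_positive (fun z => Z z - z).
Proof.
pose A n z := iter n (fun w => z + h2 (z + h1 w)) z - z.
apply: (@pick_positive_limit A).
  elim=> [|n IHn].
    move=> m w _; apply: psd_ext (@psd0 _ m) => i j.
    by rewrite /pick /A/= !subrr conjC0 subr0 mul0r.
  rewrite /A/=; apply: pick_positive_shift => //.
  exact: pick_positive_shift.
move=> z z0; have [_ _ c] := ZP z0.
exact: ccvgD c (ccvg_const _).
Qed.

Lemma pick_positive_subordination2 :
  pick_positive (fun z => (z + h1 (Z z)) - z).
Proof. exact: pick_positive_shift pick_positive_subordination. Qed.

(** At [z = in] the disk may be centred at [z] itself, with [M] governed by
    [h1 (in)] and [h2 (in)] alone; uniqueness of the fixed point then locates
    [Z (in)] in this small disk. *)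
Lemma subordination_growth (e : R) : 0 < e -> exists2 n, (0 < n)%N &
  (1 - e <= n%:R * (Im (Z (0 +i* n%:R)) / nsq (Z (0 +i* n%:R)))) /\
  (let w := 0 +i* n%:R + h1 (Z (0 +i* n%:R)) in
   1 - e <= n%:R * (Im w / nsq w)).
Proof.
move=> e0.
pose d := Num.min (1 / 8) (e / 4).
have d0 : 0 < d by rewrite lt_min !divr_gt0.
have d8 : d <= 1 / 8 by rewrite ge_min lexx.
have de : d <= e / 4 by rewrite ge_min lexx orbT.
have [n n0 [s1 s2]] := defects_small d0.
have r0 : (0 : R) < n%:R by rewrite ltr0n.
have i1 := Im_defect_le d0 s1; have i2 := Im_defect_le d0 s2.
exists n => //.
set r : R := n%:R in r0 s1 s2 i1 i2 *; set z : C := 0 +i* r in s1 s2 i1 i2 *.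
have z0 : upper z by [].
pose M := 16 / 3 * d ^+ 2 * r.
have M0 : 0 <= M by rewrite !mulr_ge0 ?sqr_ge0// ltW.
have MI : M * Im z = 16 / 3 * (d ^+ 2 * r ^+ 2) by rewrite /M/=; ring.
have Q0 : 0 <= d ^+ 2 * r ^+ 2 by rewrite mulr_ge0// sqr_ge0.
have zz h : z + h - z = h by rewrite addrC addKr.
have dr : d * r <= r / 8 by rewrite mulrC ler_pM2l// -[_^-1]mul1r.
have I1 : Im (h1 (0 +i* r)) <= r / 8 by exact: le_trans dr.
have I2 : Im (h2 (0 +i* r)) <= r / 8 by exact: le_trans dr.
have K1 : 8 / 3 * nsq (z + h1 (0 +i* r) - (0 +i* r)) <= M * Im z.
  by rewrite -/z zz MI; lra.
have K2 : 8 / 3 * nsq (z + h2 (0 +i* r) - (0 +i* r)) <= M * Im z.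
  by rewrite -/z zz MI; lra.
have Dz : disk r M z.
  by rewrite /disk subrr MI /nsq/= expr0n/= addr0; lra.
have [w [w0 wE wM _]] := shift_fixpoint p1 p2 z0 r0 M0 I1 I2 K1 K2 Dz.
have [Z0 ZE _] := ZP z0.
have Zw : Z z = w by exact: (shift_fixpoint_unique p1 p2 z0 Z0 w0 ZE wE).
have Me : M <= e ^+ 2 * r.
  rewrite /M; apply: ler_wpM2r; first exact: ltW.
  have : d ^+ 2 <= (e / 4) ^+ 2 by rewrite ler_sqr ?nnegrE ?divr_ge0// ltW.
  have := sqr_ge0 e; rewrite exprMn; nra.
rewrite Zw; split.
- apply: disk_ratio Me wM => //.
  by rewrite -Zw; exact: (Im_excess pick_positive_subordination z0).
- apply: disk_ratio Me _ => //.
    by rewrite -Zw; exact: (Im_excess pick_positive_subordination2 z0).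
  exact: disk_shift.
Qed.

End existence.

End subordination.

Theorem theorem2p1 (R : realType)
    (mu1 mu2 : probability (measurableTypeR R) R) :
  exists Z1 Z2 : R[i]%C -> R[i]%C,
    subordination_pair mu1 mu2 Z1 Z2 /\
    forall W1 W2 : R[i]%C -> R[i]%C,
      subordination_pair mu1 mu2 W1 W2 ->
      forall z : R[i]%C, upper_half_plane z -> W1 z = Z1 z /\ W2 z = Z2 z.
Proof.
have p1 := pick_multiplier_positive (pick_multiplier_defect mu1).
have p2 := pick_multiplier_positive (pick_multiplier_defect mu2).
have /choice[Z ZP] : forall z : R[i], exists w, upper_half_plane z ->
    [/\ upper_half_plane w, w = z + defect mu2 (z + defect mu1 w) &
     ccvg (fun n => iter n (fun w => z + defect mu2 (z + defect mu1 w)) z) w].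
  move=> z; have [z0|nz] := pselect (upper_half_plane z); last by exists 0.
  by have [w ?] := subordination_exists mu1 mu2 z0; exists w.
exists Z, (fun z => z + defect mu1 (Z z)); split.
  split.
  - apply: class_F_of_pick; first exact: pick_positive_subordination ZP.
    by move=> e e0; have [n n0 [g _]] := subordination_growth ZP e0; exists n.
  - apply: class_F_of_pick; first exact: pick_positive_subordination2 ZP.
    by move=> e e0; have [n n0 [_ g]] := subordination_growth ZP e0; exists n.
  - move=> z z0; have [_ ZE _] := ZP z z0; split; first by rewrite /defect; ring.
    have : Z z = z + defect mu2 (z + defect mu1 (Z z)) := ZE.
    set u := z + defect mu1 (Z z); rewrite {1}/defect => E.
    have -> : reciprocal_cauchy_transform mu2 u = Z z - z + u by rewrite E; ring.
    by rewrite /u /defect; ring.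
move=> W1 W2 [[nu W1E] _ WP] z z0.
have [ZU ZE _] := ZP z z0; have [E1 E2] := WP z z0.
have pnu := pick_multiplier_positive (pick_multiplier_defect nu).
have WU : upper_half_plane (W1 z) by rewrite W1E//; exact: (upper_excess pnu).
have W2E : W2 z = z + defect mu1 (W1 z) by rewrite [X in _ = X + _]E1 /defect; ring.
have W1E' : W1 z = z + defect mu2 (z + defect mu1 (W1 z)).
  by rewrite -W2E /defect -E2 {2}E1; ring.
have WZ : W1 z = Z z by exact: (shift_fixpoint_unique p1 p2 z0 WU ZU W1E' ZE).
by rewrite W2E WZ.
Qed.
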